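(* Let $(P,g)$ be an almost product Riemannian structure on a manifold $M$, with associated $G$-structure $P(H)$, $H=O(n_1)\times O(n_2)$, and let $\nabla$ be the Riemannian connection of $g$. Then the canonical connection $\overline\nabla$ of $(P(H),g)$ is $$\overline\nabla_XY=\nabla_XY-\tfrac12\nabla_X(P)PY=\pi_1\nabla_X\pi_1Y+\pi_2\nabla_X\pi_2Y,$$ and its second fundamental tensor field $h=\nabla-\overline\nabla$ is $$h_XY=\pi_1\nabla_X\pi_2Y+\pi_2\nabla_X\pi_1Y=\tfrac12\nabla_X(P)PY,$$ for all vector fields $X,Y$ on $M$.
   Context: An almost product Riemannian structure is a pair $(P,g)$, where $P$ is a $(1,1)$ tensor field with $P^2=I$ and $g=\langle\,,\rangle$ a Riemannian metric with $\langle PX,PY\rangle=\langle X,Y\rangle$. $\pi_1=\frac12(I+P)$, $\pi_2=\frac12(I-P)$, with images $T^1,T^2$ of ranks $n_1,n_2$; $\nabla_X(P)$ is the covariant derivative of $P$. $P(H)$ is the subbundle of the orthonormal frame bundle $O(M)$ of those frames in which $P$ has matrix $\mathrm{diag}(E_{n_1},-E_{n_2})$; its structure group is $H=O(n_1)\times O(n_2)$. Canonical connection: let $P(H)\subset O(M)$ be a principal subbundle with group $H\subset O(n)$, $\mathfrak o=\mathfrak o(n)=\mathfrak h\oplus\mathfrak m$ with $\mathfrak h$ the Lie algebra of $H$ and $\mathfrak m=\mathfrak h^\perp$ for the biinvariant Killing form. If $\omega$ is the $\mathfrak o$-valued connection form of the Riemannian connection on $O(M)$, then the $\mathfrak h$-component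 of $\omega|_{P(H)}$ is a connection form in $P(H)$; the corresponding covariant derivative is denoted $\overline\nabla$ (the canonical connection), and $h=\nabla-\overline\nabla$ is the second fundamental tensor field. *)

(* Defs.v *)
From HB Require Import structures.
From mathcomp Require Import all_boot all_order all_algebra.
From mathcomp Require Import all_classical all_reals all_analysis.
Import numFieldNormedType.Exports.

Set Implicit Arguments.
Unset Strict Implicit.
Unset Printing Implicit Defensive.

Import Order.TTheory GRing.Theory Num.Theory.

Local Open Scope classical_set_scope.
Local Open Scope ring_scope.

Section Smooth.
Variable R : realType.

Fixpoint class_C (r k : nat) (U : set 'rV[R]_k) (G : 'rV[R]_k -> R) : Prop :=
  match r with
  | 0%N => forall x, U x -> {for x, continuous G}
  | r'.+1 => (forall x, U x -> differentiable G x) /\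
             (forall v, class_C r' U (fun x => 'D_v G x))
  end.

Definition smooth_near (k : nat) (x : 'rV[R]_k) (G : 'rV[R]_k -> R) : Prop :=
  exists2 U : set 'rV[R]_k, open U /\ U x & forall r, class_C r U G.

(** [operator T] is the ambient real vector space of the tangent vectors of a
    space whose points are the elements of [T]: a tangent vector is identified
    with its action on functions. *)
Definition operator (T : Type) : Type := (T -> R) -> R.
HB.instance Definition _ (T : Type) := GRing.Lmodule.on (operator T).

(** Tangent vectors at [t], for a neighbourhood filter [nb] and a notion [sm]
    of function smooth at a point. They are derivations of the germs of smooth
    functions, in the chain rule form
      v (G (f_1, ..., f_k)) = \sum_i (D_i G) (f_1 t, ..., f_k t) * v f_i,
    of which linearity and the Leibniz rule (G = a x + b y, G = x y) are special
    cases; on a manifold Hadamard's lemma gives the converse. The value outside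
    the domain is fixed to 0, so that equal vectors are equal operators. *)
Definition tangent_vector (T : Type) (nb : T -> set_system T)
    (sm : T -> set (T -> R)) (t : T) (v : operator T) : Prop :=
  (forall f, ~ sm t f -> v f = 0) /\
  (forall (k : nat) (f : 'I_k -> T -> R) (G : 'rV[R]_k -> R) (h : T -> R),
     (forall i, sm t (f i)) ->
     smooth_near (\row_i f i t) G ->
     nb t [set s | h s = G (\row_i f i s)] ->
     v h = \sum_(i < k) 'D_(delta_mx 0 i) G (\row_j f j t) * v (f i)).

End Smooth.

Section Manifold.
Variable R : realType.

Record chart (T : topologicalType) (n : nat) := Chart {
  chart_dom : set T ;
  chart_map :> T -> 'rV[R]_n }.

Definition is_chart (T : topologicalType) (n : nat) (c : chart T n) : Prop :=
  [/\ open (chart_dom c),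
      forall p, chart_dom c p -> {for p, continuous c},
      forall p q, chart_dom c p -> chart_dom c q -> c p = c q -> p = q &
      forall V, open V -> V `<=` chart_dom c -> open (c @` V)].

Definition smooth_in_chart (T : topologicalType) (n : nat) (c : chart T n)
    (p : T) (f : T -> R) : Prop :=
  exists2 G : 'rV[R]_n -> R,
    smooth_near (c p) G & \forall q \near p, f q = G (c q).

Record manifold (n : nat) := Manifold {
  point :> topologicalType ;
  atlas : set (chart point n) ;
  manifold_hausdorff : hausdorff_space point ;
  manifold_second_countable : @second_countable point ;
  atlas_chart : forall c, atlas c -> is_chart c ;
  atlas_cover : forall p, exists2 c, atlas c & chart_dom c p ;
  atlas_compat : forall c c' p, atlas c -> atlas c' ->
    chart_dom c p -> chart_dom c' p ->
    forall i, smooth_in_chart c p (fun q => c' q 0 i) }.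

Variables (n : nat) (M : manifold n).

Definition smooth_at (p : M) (f : M -> R) : Prop :=
  exists2 c, atlas c & chart_dom c p /\ smooth_in_chart c p f.

Definition smooth (f : M -> R) : Prop := forall p, smooth_at p f.

Definition tangent : M -> set (operator R M) :=
  tangent_vector (@nbhs M M) smooth_at.

Definition field : Type := M -> operator R M.
HB.instance Definition _ := GRing.Lmodule.on field.

Definition smooth_field_at (p : M) (X : field) : Prop :=
  (\forall q \near p, tangent q (X q)) /\
  (forall f, smooth_at p f -> smooth_at p (fun q => X q f)).

Definition vector_field (X : field) : Prop := forall p, smooth_field_at p X.

Definition fscale (f : M -> R) (X : field) : field := fun p => f p *: X p.

(** Only the values of a metric, or of a (1,1) tensor field, on tangent vectors
    are meaningful. *)
Definition bilinear_field : Type := M -> operator R M -> operator R M -> R.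
Definition endo_field : Type := M -> operator R M -> operator R M.

Record riemannian_metric (g : bilinear_field) : Prop := {
  metric_linear : forall p a v w z, tangent p v -> tangent p w ->
    tangent p z -> g p (a *: v + w) z = a * g p v z + g p w z ;
  metric_sym : forall p v w, tangent p v -> tangent p w -> g p v w = g p w v ;
  metric_pos : forall p v, tangent p v -> v != 0 -> 0 < g p v v ;
  metric_smooth : forall p X Y, smooth_field_at p X -> smooth_field_at p Y ->
    smooth_at p (fun q => g q (X q) (Y q)) }.

Record affine_connection (nabla : field -> field -> field) : Prop := {
  connection_field : forall X Y, vector_field X -> vector_field Y ->
    vector_field (nabla X Y) ;
  connection_linear : forall f X X' Y, smooth f -> vector_field X ->
    vector_field X' -> vector_field Y ->
    nabla (fscale f X + X') Y = fscale f (nabla X Y) + nabla X' Y ;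
  connection_additive : forall X Y Y', vector_field X -> vector_field Y ->
    vector_field Y' -> nabla X (Y + Y') = nabla X Y + nabla X Y' ;
  connection_leibniz : forall f X Y, smooth f -> vector_field X ->
    vector_field Y ->
    nabla X (fscale f Y) =
      fscale (fun p => X p f) Y + fscale f (nabla X Y) }.

Record riemannian_connection (g : bilinear_field)
    (nabla : field -> field -> field) : Prop := {
  riemannian_affine : affine_connection nabla ;
  riemannian_torsion_free : forall X Y p f, vector_field X -> vector_field Y ->
    smooth_at p f ->
    (nabla X Y - nabla Y X) p f =
      X p (fun q => Y q f) - Y p (fun q => X q f) ;
  riemannian_metric_compat : forall X Y Z p, vector_field X ->
    vector_field Y -> vector_field Z ->
    X p (fun q => g q (Y q) (Z q)) =
      g p (nabla X Y p) (Z p) + g p (Y p) (nabla X Z p) }.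

Definition app (P : endo_field) (X : field) : field := fun p => P p (X p).

Definition pi1 (P : endo_field) : endo_field := fun p v => 2^-1 *: (v + P p v).
Definition pi2 (P : endo_field) : endo_field := fun p v => 2^-1 *: (v - P p v).

Definition has_dim (S : set (operator R M)) (k : nat) : Prop :=
  exists2 b : 'I_k -> operator R M, (forall i, S (b i)) &
    forall v, S v -> exists! c : 'rV[R]_k, v = \sum_(i < k) c 0 i *: b i.

Record almost_product_riemannian (P : endo_field) (g : bilinear_field)
    (n1 n2 : nat) : Prop := {
  ap_metric : riemannian_metric g ;
  ap_tangent : forall p v, tangent p v -> tangent p (P p v) ;
  ap_linear : forall p a v w, tangent p v -> tangent p w ->
    P p (a *: v + w) = a *: P p v + P p w ;
  ap_smooth : forall p X, smooth_field_at p X -> smooth_field_at p (app P X) ;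
  ap_square : forall p v, tangent p v -> P p (P p v) = v ;
  ap_isometry : forall p v w, tangent p v -> tangent p w ->
    g p (P p v) (P p w) = g p v w ;
  ap_rank1 : forall p, has_dim (pi1 P p @` tangent p) n1 ;
  ap_rank2 : forall p, has_dim (pi2 P p @` tangent p) n2 }.

Definition cov_endo (nabla : field -> field -> field) (X : field)
    (P : endo_field) (Y : field) : field :=
  nabla X (app P Y) - app P (nabla X Y).

(** A frame [(p, (u_i)_i)] is identified with the map
    [frame_map : R^n -> T_p M], x |-> \sum_i x_i u_i. *)
Definition frame : Type := (M * ('I_n -> operator R M))%type.

Definition frame_map (u : frame) (x : 'cV[R]_n) : operator R M :=
  \sum_(i < n) x i 0 *: u.2 i.

Definition frame_act (u : frame) (a : 'M[R]_n) : frame :=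
  (u.1, fun j => \sum_(i < n) a i j *: u.2 i).

Definition orthonormal_frames (g : bilinear_field) : set frame :=
  [set u | (forall i, tangent u.1 (u.2 i)) /\
           (forall i j, g u.1 (u.2 i) (u.2 j) = (i == j)%:R)].

(** For an orthonormal frame [w] this is the coordinate vector of [Y] in [w],
    i.e. the R^n-valued function on O(M) associated with [Y]. *)
Definition frame_coords (g : bilinear_field) (Y : field) (w : frame) :
    'cV[R]_n :=
  \col_i g w.1 (w.2 i) (Y w.1).

(** The smooth structure of O(M) is generated by the functions pulled back from
    M and the coordinates [frame_coords g Y]: taking for [Y] the members of a
    local frame of TM, and the coordinates of a chart, one recovers local
    coordinates of the full frame bundle, of which O(M) is an embedded
    submanifold. *)
Definition frame_generator (g : bilinear_field) (u : frame) :
    set (frame -> R) :=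
  [set phi | (exists2 f, smooth_at u.1 f & phi = fun w => f w.1) \/
     (exists i Y, smooth_field_at u.1 Y /\
                  phi = fun w => frame_coords g Y w i 0)].

Definition frame_nbhs (g : bilinear_field) (u : frame) : set_system frame :=
  [set A | exists (V : set M) (k : nat) (phi : 'I_k -> frame -> R)
                  (N : set 'rV[R]_k),
     [/\ nbhs u.1 V, forall i, frame_generator g u (phi i),
         nbhs (\row_i phi i u) N &
         forall w, orthonormal_frames g w -> V w.1 -> N (\row_i phi i w) ->
           A w]].

Definition frame_smooth_at (g : bilinear_field) (u : frame) :
    set (frame -> R) :=
  [set F | exists (k : nat) (phi : 'I_k -> frame -> R) (G : 'rV[R]_k -> R),
     [/\ forall i, frame_generator g u (phi i),
         smooth_near (\row_i phi i u) G &
         frame_nbhs g u [set w | F w = G (\row_i phi i w)]]].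

(** The tangent space at [u] of a submanifold [Q] of O(M), as a subspace of
    T_u O(M). *)
Definition tangent_sub (g : bilinear_field) (Q : set frame) (u : frame) :
    set (operator R frame) :=
  [set xi | tangent_vector (frame_nbhs g) (frame_smooth_at g) u xi /\
     (forall F, frame_smooth_at g u F ->
        frame_nbhs g u [set w | Q w -> F w = 0] -> xi F = 0)].

Definition smooth_on_sub (g : bilinear_field) (Q : set frame) (u : frame)
    (F : frame -> R) : Prop :=
  exists2 F', frame_smooth_at g u F' &
    frame_nbhs g u [set w | Q w -> F w = F' w].

(** [xi] projects to [v] under the differential of O(M) -> M. *)
Definition lies_over (u : frame) (xi : operator R frame) (v : operator R M) :
    Prop :=
  forall f, smooth_at u.1 f -> xi (fun w => f w.1) = v f.

Definition in_On : set 'M[R]_n := [set a | a^T *m a = 1%:M].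

(** Lie algebra of a closed subgroup [H] of O(n). *)
Definition lie_algebra (H : set 'M[R]_n) : set 'M[R]_n :=
  [set A | exists a : R -> 'M[R]_n,
     [/\ forall t, H (a t), a 0 = 1%:M & is_derive (0 : R) (1 : R) a A]].

(** The value at [u] of the fundamental vector field of [A]. *)
Definition fundamental (g : bilinear_field) (Q : set frame)
    (H : set 'M[R]_n) (A : 'M[R]_n) (u : frame) (xi : operator R frame) :
    Prop :=
  tangent_sub g Q u xi /\
  exists a : R -> 'M[R]_n,
    [/\ forall t, H (a t), a 0 = 1%:M, is_derive (0 : R) (1 : R) a A &
        forall F, frame_smooth_at g u F ->
          is_derive (0 : R) (1 : R) (fun t => F (frame_act u (a t))) (xi F)].

Definition one_form : Type := frame -> operator R frame -> 'M[R]_n.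

Record connection_form (g : bilinear_field) (Q : set frame)
    (H : set 'M[R]_n) (omega : one_form) : Prop := {
  form_lie : forall u xi, Q u -> tangent_sub g Q u xi ->
    lie_algebra H (omega u xi) ;
  form_linear : forall u a xi zeta, Q u -> tangent_sub g Q u xi ->
    tangent_sub g Q u zeta ->
    omega u (a *: xi + zeta) = a *: omega u xi + omega u zeta ;
  form_smooth : forall Xi : frame -> operator R frame,
    (forall u, Q u -> tangent_sub g Q u (Xi u)) ->
    (forall u F, Q u -> frame_smooth_at g u F ->
       smooth_on_sub g Q u (fun w => Xi w F)) ->
    forall u i j, Q u -> smooth_on_sub g Q u (fun w => omega w (Xi w) i j) ;
  form_vertical : forall u A xi, Q u -> lie_algebra H A ->
    fundamental g Q H A u xi -> omega u xi = A ;
  form_equivariant : forall u a xi, Q u -> H a -> tangent_sub g Q u xi ->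
    omega (frame_act u a) (fun F => xi (fun w => F (frame_act w a))) =
      invmx a *m omega u xi *m a }.

(** The covariant derivative of a connection form on [Q]: the function on [Q]
    associated with [nabla X Y] is the exterior covariant derivative
    dF + omega F, F = frame_coords g Y, on any vector tangent to [Q] over [X]
    (for a horizontal vector, this is just dF). *)
Definition covariant_derivative (g : bilinear_field) (Q : set frame)
    (omega : one_form) (nabla : field -> field -> field) : Prop :=
  forall X Y u xi, vector_field X -> vector_field Y -> Q u ->
    tangent_sub g Q u xi -> lies_over u xi (X u.1) ->
    nabla X Y u.1 =
      frame_map u (\col_i xi (fun w => frame_coords g Y w i 0)
                   + omega u xi *m frame_coords g Y u).

(** [B] is the component of [A] in h, for o(n) = h + m with m orthogonal to h.
    The Killing form of o(n) is (n - 2) tr (A B), which vanishes for n = 2; the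
    invariant form tr (A B), definite for every n, is used instead. *)
Definition lie_component (H : set 'M[R]_n) (A B : 'M[R]_n) : Prop :=
  lie_algebra H B /\ (forall C, lie_algebra H C -> \tr ((A - B) *m C) = 0).

Definition canonical_connection (g : bilinear_field) (Q : set frame)
    (H : set 'M[R]_n) (omega : one_form) (nablabar : field -> field -> field) :
    Prop :=
  exists2 omega_h : one_form,
    (forall u xi, Q u -> tangent_sub g Q u xi ->
       lie_component H (omega u xi) (omega_h u xi)) &
    covariant_derivative g Q omega_h nablabar.

End Manifold.

Section AlmostProduct.
Variables (R : realType) (n1 n2 : nat) (M : manifold R (n1 + n2)).

Definition in_On1xOn2 : set 'M[R]_(n1 + n2) :=
  [set a | exists (a1 : 'M[R]_n1) (a2 : 'M[R]_n2),
     [/\ in_On a1, in_On a2 & a = block_mx a1 0 0 a2]].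

Definition adapted_frames (g : bilinear_field M) (P : endo_field M) :
    set (frame M) :=
  [set u | orthonormal_frames g u /\
     forall x : 'cV[R]_(n1 + n2),
       P u.1 (frame_map u x) =
       frame_map u ((block_mx 1%:M 0 0 (-1)%:M : 'M[R]_(n1 + n2)) *m x)].

End AlmostProduct.

(* Main.v *)
Require Import Defs.
From mathcomp Require Import all_boot all_order all_algebra.
From mathcomp Require Import all_classical all_reals all_analysis.
From mathcomp Require Import ring.
Import numFieldNormedType.Exports.

(** Why the theorem holds. In an adapted frame [P] is the constant matrix
    J = diag(1, ..., 1, -1, ..., -1). The group O(n1) x O(n2) is the centralizer
    of J in O(n), so its Lie algebra consists of the antisymmetric C with
    J C J = C, and the orthogonal component in it of an antisymmetric matrix A
    is (A + J A J) / 2. On the adapted frames the coordinates of P Y are J times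
    those of Y, hence so are their derivatives along vectors tangent to P(H), and
    conjugating the connection form by J amounts to conjugating the covariant
    derivative by P. Therefore the component (A + J A J) / 2 defines the
    covariant derivative
      nablabar_X Y = (nabla_X Y + P nabla_X (P Y)) / 2
    ([block_part_derivative]), which proves existence; the four formulas are
    algebraic rearrangements of this one.

    For an arbitrary canonical connection, [lie_component_unique] identifies its
    form. To read off its value at a point p from the equation that defines a
    covariant derivative, one also needs an adapted frame at p and a vector
    tangent to P(H) there that lies over X p. Both come from a smooth local
    section of P(H) ([adapted_local_frame], [frame_pushforward_tangent]): a basis
    of eigenvectors of P at p is extended to fields with constant components in
    a chart, projected to the eigenbundles and orthonormalized.

    The supporting theory is the stability of smoothness under composition, in
    R^k ([smooth_near_comp]), on the manifold ([smooth_at_comp]) and on the frame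
    bundle ([frame_smooth_comp]), and for the Lie algebra the Cayley transform,
    which provides a curve in the group with a given antisymmetric velocity. *)

Set Implicit Arguments.
Unset Strict Implicit.
Unset Printing Implicit Defensive.

Import Order.TTheory GRing.Theory Num.Theory.

Local Open Scope classical_set_scope.
Local Open Scope ring_scope.

(** * Smooth functions on R^k *)

Lemma near_eq_differentiable (R : numFieldType) (V W : normedModType R)
    (f g : V -> W) (x : V) :
  (\near x, f x = g x) -> differentiable f x -> differentiable g x.
Proof.
move=> fg df; have gx := nbhs_singleton fg.
apply/diffP.
apply: (@getPex _ (fun (df : {linear V -> W}) => continuous df /\
  forall y, g y = g (lim (nbhs x)) + df (y - lim (nbhs x))
                  +o_(y \near x) (y - lim (nbhs x)))).
exists ('d f x); split; first exact: diff_continuous.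
have E : g = cst (g x) + 'd f x \o center x +o_ x (center x).
  apply/eqaddoP => e e0.
  case: df => -[_]; rewrite lim_id// => /eqaddoP/(_ _ e0).
  by apply: filterS2 fg => y; rewrite !fctE gx => ->.
by rewrite lim_id// => y; exact: (congr1 (fun h : V -> W => h y) E).
Qed.

Section ClassC.
Variable R : realType.
Implicit Types (k m r : nat).

Lemma cvg_row (T : Type) (F : set_system T) {FF : Filter F} m
    (f : 'I_m -> T -> R) (a : 'I_m -> R) :
  (forall i, f i x @[x --> F] --> a i) ->
  (\row_i f i x) @[x --> F] --> \row_i a i.
Proof.
move=> fa A [B nB BA].
have : \forall x \near F, forall i, B 0 i (f i x).
  by apply: filter_forall => i; apply: fa; have := nB 0 i; rewrite mxE.
by apply: filterS => x Bx; apply: BA => i j; rewrite ord1 mxE.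
Qed.

Lemma differentiable_row (V : normedModType R) m (f : 'I_m -> V -> R) (x : V) :
  (forall i, differentiable (f i) x) ->
  differentiable (fun y => \row_i f i y) x.
Proof.
move=> df.
have -> : (fun y => \row_i f i y) =
    \sum_(i < m) (fun y => f i y *: (delta_mx 0 i : 'rV[R]_m)).
  by apply/funext => y; rewrite fct_sumE [LHS]row_sum_delta; under eq_bigr do rewrite mxE.
by apply: differentiable_sum => i; apply: differentiableZl.
Qed.

(** The chain rule in the form in which tangent vectors are defined. *)
Lemma derive_comp_row (V : normedModType R) m (f : 'I_m -> V -> R)
    (G : 'rV[R]_m -> R) (x v : V) :
  (forall i, differentiable (f i) x) -> differentiable G (\row_i f i x) ->
  'D_v (fun y => G (\row_i f i y)) x =
    \sum_(i < m) 'D_(delta_mx 0 i) G (\row_j f j x) * 'D_v (f i) x.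
Proof.
move=> df dG; pose h y : 'rV[R]_m := \row_i f i y.
have dh : differentiable h x by exact: differentiable_row.
rewrite (_ : (fun y => _) = G \o h)// deriveE; last exact: differentiable_comp.
rewrite diff_comp//= -(deriveE v dh) derive_mx; last exact: diff_derivable.
rewrite [X in 'd G _ X]row_sum_delta linear_sum; apply: eq_bigr => i _.
rewrite linearZ/= mulrC -deriveE//; congr (_ * _); rewrite mxE.
by congr ('D_v _ x); apply/funext => y; rewrite mxE.
Qed.

Lemma derive_coord k (x v : 'rV[R]_k) i :
  'D_v (fun y : 'rV[R]_k => y 0 i) x = v 0 i.
Proof.
have := derive_mx (@derivable_id R _ x v).
by rewrite derive_id => /matrixP/(_ 0 i); rewrite mxE.
Qed.

Lemma class_C_sub r k (U V : set 'rV[R]_k) (G : 'rV[R]_k -> R) :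
  V `<=` U -> class_C r U G -> class_C r V G.
Proof.
elim: r G => [|r IH] G VU /=; first by move=> H x /VU /H.
by move=> [d D]; split=> [x /VU /d//|v]; exact: IH.
Qed.

Lemma class_C_eq r k (U : set 'rV[R]_k) (G H : 'rV[R]_k -> R) :
  open U -> (forall x, U x -> G x = H x) -> class_C r U G -> class_C r U H.
Proof.
elim: r G H => [|r IH] G H Uo GH /=.
  move=> cG x Ux; have nGH : \near x, G x = H x.
    exact: filterS GH (open_nbhs_nbhs (conj Uo Ux)).
  rewrite /prop_for /continuous_at -(GH _ Ux).
  by apply: cvg_trans (cG x Ux); exact: (near_eq_cvg nGH).
have nGH x : U x -> \near x, G x = H x.
  by move=> Ux; exact: filterS GH (open_nbhs_nbhs (conj Uo Ux)).
move=> [d D]; split=> [x Ux|v].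
  exact: near_eq_differentiable (nGH x Ux) (d x Ux).
apply: IH (D v) => // x Ux.
exact/near_eq_derive/nGH.
Qed.

Lemma class_CS r k (U : set 'rV[R]_k) (G : 'rV[R]_k -> R) :
  class_C r.+1 U G -> class_C r U G.
Proof.
elim: r G => [|r IH] G.
  by move=> [d _] x Ux; exact/differentiable_continuous/d.
by move=> [d D]; split => // v; apply: IH; exact: D.
Qed.

Lemma class_C_cst r k (U : set 'rV[R]_k) (a : R) : class_C r U (fun=> a).
Proof.
elim: r a => [|r IH] a /=; first by move=> x _; exact: cst_continuous.
split => [x _|v]; first exact: differentiable_cst.
by rewrite (_ : 'D_v _ = (fun=> 0))//; apply/funext => x; exact: derive_cst.
Qed.

Lemma class_C_coord r k (U : set 'rV[R]_k) i : class_C r U (fun x => x 0 i).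
Proof.
case: r => [|r] /=; first by move=> x _; exact: coord_continuous.
split => [x _|v]; first exact: differentiable_coord.
rewrite (_ : 'D_v _ = (fun=> v 0 i)); first exact: class_C_cst.
by apply/funext => x; exact: derive_coord.
Qed.

Lemma class_CD r k (U : set 'rV[R]_k) (F G : 'rV[R]_k -> R) : open U ->
  class_C r U F -> class_C r U G -> class_C r U (fun x => F x + G x).
Proof.
move=> Uo; elim: r F G => [|r IH] F G /=.
  by move=> cF cG x Ux; apply: continuousD; [exact: cF|exact: cG].
move=> [dF DF] [dG DG]; split => [x Ux|v].
  by apply: differentiableD; [exact: dF|exact: dG].
apply: class_C_eq (IH _ _ (DF v) (DG v)) => // x Ux.
by rewrite deriveD//; apply: diff_derivable; [exact: dF|exact: dG].
Qed.

Lemma class_CM r k (U : set 'rV[R]_k) (F G : 'rV[R]_k -> R) : open U ->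
  class_C r U F -> class_C r U G -> class_C r U (fun x => F x * G x).
Proof.
move=> Uo; elim: r F G => [|r IH] F G.
  by move=> cF cG x Ux; apply: continuousM; [exact: cF|exact: cG].
move=> CF CG; have [[dF DF] [dG DG]] := (CF, CG); split => [x Ux|v].
  by apply: differentiableM; [exact: dF|exact: dG].
have C := class_CD Uo (IH _ _ (class_CS CF) (DG v)) (IH _ _ (class_CS CG) (DF v)).
apply: class_C_eq C => // x Ux.
by rewrite deriveM//; apply: diff_derivable; [exact: dF|exact: dG].
Qed.

Lemma class_C_sum r k (U : set 'rV[R]_k) (I : finType) (F : I -> 'rV[R]_k -> R) :
  open U -> (forall i, class_C r U (F i)) -> class_C r U (fun x => \sum_i F i x).
Proof.
move=> Uo CF; rewrite /index_enum -enumT; elim: (enum I) => [|i s IH].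
  rewrite (_ : (fun=> _) = (fun=> 0)); first exact: class_C_cst.
  by apply/funext => x; rewrite big_nil.
rewrite (_ : (fun x => _) = (fun x => F i x + \sum_(i <- s) F i x)).
  exact: class_CD.
by apply/funext => x; rewrite big_cons.
Qed.

(** The derivative of a composite is a sum of products of the first derivatives,
    which are of class one less: hence the induction on the class. *)
Lemma class_C_comp r k m (U : set 'rV[R]_k) (V : set 'rV[R]_m)
    (f : 'I_m -> 'rV[R]_k -> R) (G : 'rV[R]_m -> R) : open U ->
  (forall x, U x -> V (\row_i f i x)) ->
  (forall i, class_C r U (f i)) -> class_C r V G ->
  class_C r U (fun x => G (\row_i f i x)).
Proof.
move=> Uo UV; elim: r f G UV => [|r IH] f G UV Cf CG.
  move=> x Ux; pose h y : 'rV[R]_m := \row_i f i y.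
  rewrite (_ : (fun y => _) = G \o h)//; apply: continuous_comp; last exact/CG/UV.
  exact: (@cvg_row _ (nbhs x) _ _ f (f ^~ x) (fun i => Cf i x Ux)).
have [dG DG] := CG; split=> [x Ux|v].
  apply: (@differentiable_comp _ _ _ _ (fun y => \row_i f i y)).
    by apply: differentiable_row => i; have [d _] := Cf i; exact: d.
  exact/dG/UV.
have C : class_C r U (fun x => \sum_(i < m)
    'D_(delta_mx 0 i) G (\row_j f j x) * 'D_v (f i) x).
  apply: class_C_sum => // i; apply: class_CM => //; last exact: (Cf i).2.
  by apply: (IH f ('D_(delta_mx 0 i) G)) => [//|j|]; [exact: class_CS|exact: DG].
apply: class_C_eq C => // x Ux.
rewrite derive_comp_row// => [i|]; first by have [d _] := Cf i; exact: d.
exact/dG/UV.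
Qed.

Lemma smooth_near_differentiable k (x : 'rV[R]_k) G :
  smooth_near x G -> differentiable G x.
Proof. by move=> [U [_ Ux] /(_ 1%N)[d _]]; exact: d. Qed.

Lemma smooth_near_near k (x : 'rV[R]_k) G :
  smooth_near x G -> \near x, smooth_near x G.
Proof.
move=> [U [Uo Ux] C]; apply: filterS (open_nbhs_nbhs (conj Uo Ux)) => y Uy.
by exists U.
Qed.

Lemma smooth_near_derive k (x : 'rV[R]_k) v G :
  smooth_near x G -> smooth_near x (fun y => 'D_v G y).
Proof. by move=> [U Ux C]; exists U => // r; have [_] := C r.+1; exact. Qed.

Lemma smooth_near_cst k (x : 'rV[R]_k) a : smooth_near x (fun=> a).
Proof.
by exists setT => [|r]; [split; [exact: openT|]|exact: class_C_cst].
Qed.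

Lemma smooth_near_coord k (x : 'rV[R]_k) i : smooth_near x (fun y => y 0 i).
Proof.
by exists setT => [|r]; [split; [exact: openT|]|exact: class_C_coord].
Qed.

(** The composite is smooth on the set of points at which every [f i] is smooth
    and whose image lies in the domain of [G]; this set is open by continuity. *)
Lemma smooth_near_comp k m (x : 'rV[R]_k) (f : 'I_m -> 'rV[R]_k -> R) G :
  (forall i, smooth_near x (f i)) -> smooth_near (\row_i f i x) G ->
  smooth_near x (fun y => G (\row_i f i y)).
Proof.
move=> sf [V [Vo Vx] CG].
pose h y : 'rV[R]_m := \row_i f i y.
pose A := [set y | (forall i, smooth_near y (f i)) /\ V (h y)].
have ch y : (forall i, smooth_near y (f i)) -> {for y, continuous h}.
  move=> s; apply/differentiable_continuous/differentiable_row => i.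
  exact: smooth_near_differentiable.
have Ao : open A.
  rewrite openE => y [sy Vy]; rewrite /interior/=.
  have H1 : \forall z \near y, forall i, smooth_near z (f i).
    apply: (@filter_forall _ _ (fun i z => smooth_near z (f i)) (nbhs (y : 'rV[R]_k))) => i.
    exact: smooth_near_near.
  have H2 : \forall z \near y, V (h z).
    by apply: (ch y sy); exact: open_nbhs_nbhs.
  by near=> z; split; near: z.
exists A => // r; apply: (class_C_comp (V := V)) => // [y [_]//|i].
elim: r {CG} (f i) (fun y (Ay : A y) => Ay.1 i) => [|r IH] F sF.
  by move=> y /sF/smooth_near_differentiable/differentiable_continuous.
split=> [y /sF/smooth_near_differentiable//|v].
by apply: IH => y /sF; exact: smooth_near_derive.
Unshelve. all: by end_near. Qed.

Lemma smooth_nearD k (x : 'rV[R]_k) F G :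
  smooth_near x F -> smooth_near x G -> smooth_near x (fun y => F y + G y).
Proof.
move=> [U [Uo Ux] CF] [V [Vo Vx] CG]; exists (U `&` V).
  by split => //; exact: openI.
move=> r; apply: class_CD; first exact: openI.
  by apply: class_C_sub (CF r); exact: subIsetl.
by apply: class_C_sub (CG r); exact: subIsetr.
Qed.

Lemma smooth_nearM k (x : 'rV[R]_k) F G :
  smooth_near x F -> smooth_near x G -> smooth_near x (fun y => F y * G y).
Proof.
move=> [U [Uo Ux] CF] [V [Vo Vx] CG]; exists (U `&` V).
  by split => //; exact: openI.
move=> r; apply: class_CM; first exact: openI.
  by apply: class_C_sub (CF r); exact: subIsetl.
by apply: class_C_sub (CG r); exact: subIsetr.
Qed.

(** The derivatives of a power are multiples of powers, so the induction on the
    class runs over all exponents at once. *)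
Lemma smooth_near_powR (a : R) (x : 'rV[R]_1) :
  0 < x 0 0 -> smooth_near x (fun y => y 0 0 `^ a).
Proof.
move=> x0; pose U := [set y : 'rV[R]_1 | 0 < y 0 0].
have Uo : open U.
  rewrite (_ : U = (fun y : 'rV[R]_1 => y 0 0) @^-1` [set y | 0 < y])//.
  by apply: open_comp => [y _|]; [exact: coord_continuous|exact: open_gt].
have dP b (y : 'rV[R]_1) : U y -> differentiable (fun t : R => t `^ b) (y 0 0).
  move=> Uy; apply/derivable1_diffP; apply: derivable_powR.
  by rewrite in_itv/= andbT.
have dU b (y : 'rV[R]_1) : U y -> differentiable (fun y : 'rV[R]_1 => y 0 0 `^ b) y.
  move=> Uy; apply: (@differentiable_comp _ _ _ _ (fun y : 'rV[R]_1 => y 0 0)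
    (fun t : R => t `^ b)); [exact: differentiable_coord|exact: dP].
exists U => // r; elim: r a => [|r IH] a /=.
  by move=> y /(dU a)/differentiable_continuous.
split=> [y|v]; first exact: dU.
have := class_CM Uo (class_C_cst r U (a * v 0 0)) (IH (a - 1)).
apply: class_C_eq => // y Uy.
rewrite deriveE; last exact: dU.
rewrite (_ : (fun y : 'rV[R]_1 => _) = (fun t : R => t `^ a) \o (fun y : 'rV[R]_1 => y 0 0))//.
rewrite diff_comp; [|exact: differentiable_coord|exact: dP].
rewrite /= -(deriveE _ (@differentiable_coord _ _ _ y 0 0)).
rewrite derive_coord.
have := @is_derive1_powR R a (y 0 0) Uy => -[_ H].
rewrite -[v 0 0 in RHS]mulr1 [RHS]linearZ/= -deriveE; last exact: dP.
by rewrite H -[_ *: _]/(_ * _) mulrAC mulrC.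
Qed.

End ClassC.

(** * Tangent vectors as derivations *)

Section TangentVector.
Variables (R : realType) (T : Type) (nb : T -> set_system T).
Variable sm : T -> set (T -> R).
Implicit Types (t : T) (v : operator R T).

Lemma tangent_vector_chain t v k (f : 'I_k -> T -> R) G h :
  tangent_vector nb sm t v -> (forall i, sm t (f i)) ->
  smooth_near (\row_i f i t) G -> nb t [set s | h s = G (\row_i f i s)] ->
  v h = \sum_(i < k) 'D_(delta_mx 0 i) G (\row_j f j t) * v (f i).
Proof. by move=> [_]; apply. Qed.

(** The chain rule with an empty family of inner functions. *)
Lemma tangent_vector_cst t v a h : tangent_vector nb sm t v ->
  nb t [set s | h s = a] -> v h = 0.
Proof.
move=> tv ha; pose f (i : 'I_0) : T -> R := fun=> 0.
rewrite (@tangent_vector_chain t v 0 f (fun=> a) h)//.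
- by rewrite big_ord0.
- by case.
- exact: smooth_near_cst.
Qed.

(** The chain rule for G(x, y) = x + a y. The function [h] need only agree with
    the combination near [t], so this contains locality as well. *)
Lemma tangent_vector_lin t v f1 f2 a h : tangent_vector nb sm t v ->
  sm t f1 -> sm t f2 -> nb t [set s | h s = f1 s + a * f2 s] ->
  v h = v f1 + a * v f2.
Proof.
move=> tv s1 s2 hf.
pose F (i : 'I_2) := if i == 0 then f1 else f2.
pose G (x : 'rV[R]_2) := x 0 0 + a * x 0 1.
have DG x i : 'D_(delta_mx 0 i) G x = (if i == 0 then 1 else a).
  have dc j : derivable (fun x : 'rV[R]_2 => x 0 j) x (delta_mx 0 i).
    exact/diff_derivable/differentiable_coord.
  rewrite [G](_ : _ = (fun x : 'rV[R]_2 => x 0 0) + a *: (fun x : 'rV[R]_2 => x 0 1))//.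
  rewrite deriveD//; last exact: derivableZ.
  rewrite deriveZ// !derive_coord !mxE !eqxx -[_ *: _]/(_ * _)/=.
  case: i {dc} => -[|[|//]] ltn.
  - by rewrite (_ : (0 == _) = true)// (_ : (1 == _) = false)// eq_sym mulr0 addr0.
  - by rewrite (_ : (0 == _) = false)// (_ : (1 == _) = true)// mulr1 add0r.
rewrite (@tangent_vector_chain t v 2 F G h)//.
- by rewrite !big_ord_recr big_ord0 !DG /= add0r mul1r.
- by move=> i; rewrite /F; case: ifP.
- apply: smooth_nearD; first exact: smooth_near_coord.
  by apply: smooth_nearM; [exact: smooth_near_cst|exact: smooth_near_coord].
- rewrite (_ : [set s | _] = [set s | h s = f1 s + a * f2 s])//.
  by apply/funext => s; rewrite /G /= !mxE.
Qed.

Lemma tangent_vector_linear t v w (a : R) : tangent_vector nb sm t v ->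
  tangent_vector nb sm t w -> tangent_vector nb sm t (a *: v + w).
Proof.
move=> tv tw; split=> [f nf|k f G h sf sG hG].
  by rewrite -[LHS]/(a * v f + w f) tv.1// tw.1// mulr0 addr0.
rewrite -[LHS]/(a * v h + w h) (tangent_vector_chain tv sf sG hG).
rewrite (tangent_vector_chain tw sf sG hG) mulr_sumr -big_split/=.
by apply: eq_bigr => i _; rewrite mulrCA -mulrDr.
Qed.

Lemma tangent_vector0 t : tangent_vector nb sm t 0.
Proof.
split=> // k f G h _ _ _.
by rewrite big1// => i _; rewrite -[X in _ * X]/(0 : R) mulr0.
Qed.

Lemma tangent_vectorZ t v (a : R) : tangent_vector nb sm t v ->
  tangent_vector nb sm t (a *: v).
Proof.
by move=> tv; rewrite -[_ *: _]addr0; apply: tangent_vector_linear => //; exact: tangent_vector0.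
Qed.

Lemma tangent_vectorD t v w : tangent_vector nb sm t v ->
  tangent_vector nb sm t w -> tangent_vector nb sm t (v + w).
Proof. by move=> tv tw; rewrite -[v]scale1r; exact: tangent_vector_linear. Qed.

End TangentVector.

(** * Smooth functions and vector fields on a manifold *)

Section Charts.
Variables (R : realType) (n : nat) (M : manifold R n).
Implicit Types (p q : M) (c : chart R M n) (f h : M -> R).

(** A chart is a local homeomorphism, so neighbourhoods can be transported
    between a point and its coordinates. *)
Lemma chart_push c p (A : set 'rV[R]_n) : is_chart c -> chart_dom c p ->
  (\forall q \near p, A (c q)) -> \forall x \near c p, A x.
Proof.
move=> [co _ _ cV] cp; move=> Wp; pose W := interior [set q | A (c q)].
have Wo : open W by exact: open_interior.
have Wco : open (W `&` chart_dom c) by exact: openI.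
have := cV _ Wco (@subIsetr _ _ _) => cWo.
have cWp : (c @` (W `&` chart_dom c)) (c p) by exists p.
apply: filterS (open_nbhs_nbhs (conj cWo cWp)) => _ [q [Wq _] <-].
exact: (interior_subset Wq).
Qed.

Lemma chart_pull c p (A : set 'rV[R]_n) : is_chart c -> chart_dom c p ->
  (\forall x \near c p, A x) -> \forall q \near p, A (c q).
Proof. by move=> [_ cc _ _] cp; exact: cc. Qed.

Lemma chart_near c p : is_chart c -> chart_dom c p -> \forall q \near p, chart_dom c q.
Proof. by move=> [co _ _ _] cp; exact: open_nbhs_nbhs. Qed.

Lemma chart_row c p : \row_i c p 0 i = c p.
Proof. by apply/rowP => i; rewrite mxE. Qed.

Lemma smooth_in_chart_comp c p k (f : 'I_k -> M -> R) G h :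
  (forall i, smooth_in_chart c p (f i)) -> smooth_near (\row_i f i p) G ->
  (\forall q \near p, h q = G (\row_i f i q)) -> smooth_in_chart c p h.
Proof.
move=> sf sG hG.
have /choice[F FP] : forall i, exists F : 'rV[R]_n -> R, smooth_near (c p) F /\
    \forall q \near p, f i q = F (c q).
  by move=> i; have [F] := sf i; exists F.
exists (fun x => G (\row_i F i x)).
  apply: smooth_near_comp => [i|]; first exact: (FP i).1.
  rewrite (_ : \row_i _ = \row_i f i p)//; apply/rowP => i; rewrite !mxE.
  by rewrite (nbhs_singleton (FP i).2).
have : \forall q \near p, forall i, f i q = F i (c q).
  by apply: filter_forall => i; exact: (FP i).2.
apply: filterS2 hG => q -> fF; congr G; apply/rowP => i; rewrite !mxE.
exact: fF.
Qed.

(** The coordinates of one chart are smooth in any other, so smoothness at [p]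
    can be tested in every chart at [p]. *)
Lemma smooth_atE c p f : atlas c -> chart_dom c p ->
  smooth_at p f <-> smooth_in_chart c p f.
Proof.
move=> ac cp; split=> [[c' ac' [c'p [G sG fG]]]|]; last by exists c.
apply: (@smooth_in_chart_comp c p n (fun i q => c' q 0 i) G).
- by move=> i; exact: atlas_compat.
- by rewrite chart_row.
- by apply: filterS fG => q ->; rewrite chart_row.
Qed.

Lemma smooth_at_comp p k (f : 'I_k -> M -> R) G h :
  (forall i, smooth_at p (f i)) -> smooth_near (\row_i f i p) G ->
  (\forall q \near p, h q = G (\row_i f i q)) -> smooth_at p h.
Proof.
have [c ac cp] := atlas_cover p.
move=> sf sG hG; apply/(smooth_atE h ac cp); apply: smooth_in_chart_comp hG => //.
by move=> i; apply/smooth_atE.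
Qed.

Lemma smooth_at_eq p f h : smooth_at p f -> (\forall q \near p, h q = f q) ->
  smooth_at p h.
Proof.
move=> sf hf; apply: (@smooth_at_comp p 1 (fun=> f) (fun x => x 0 0)) => //.
  exact: smooth_near_coord.
by apply: filterS hf => q ->; rewrite mxE.
Qed.

Lemma smooth_at_cst p (a : R) : smooth_at p (fun=> a).
Proof.
apply: (@smooth_at_comp p 0 (fun=> fun=> 0) (fun=> a)) => [[]//||].
  exact: smooth_near_cst.
exact: nearW.
Qed.

Lemma smooth_atD p f h : smooth_at p f -> smooth_at p h ->
  smooth_at p (fun q => f q + h q).
Proof.
move=> sf sh.
apply: (@smooth_at_comp p 2 (fun i => if i == 0 then f else h)
  (fun x => x 0 0 + x 0 1)) => [i||]; first by case: ifP.
  by apply: smooth_nearD; exact: smooth_near_coord.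
by apply: nearW => q; rewrite !mxE.
Qed.

Lemma smooth_atM p f h : smooth_at p f -> smooth_at p h ->
  smooth_at p (fun q => f q * h q).
Proof.
move=> sf sh.
apply: (@smooth_at_comp p 2 (fun i => if i == 0 then f else h)
  (fun x => x 0 0 * x 0 1)) => [i||]; first by case: ifP.
  by apply: smooth_nearM; exact: smooth_near_coord.
by apply: nearW => q; rewrite !mxE.
Qed.

Lemma smooth_at_powR p f (a : R) : smooth_at p f -> 0 < f p ->
  smooth_at p (fun q => f q `^ a).
Proof.
move=> sf fp.
apply: (@smooth_at_comp p 1 (fun=> f) (fun x => x 0 0 `^ a)) => //.
  by apply: smooth_near_powR; rewrite mxE.
by apply: nearW => q; rewrite mxE.
Qed.

Lemma smooth_at_continuous p f : smooth_at p f -> {for p, continuous f}.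
Proof.
have [c ac cp] := atlas_cover p; have [_ cc _ _] := atlas_chart ac.
move=> /(smooth_atE f ac cp)[G sG fG].
have cG : {for p, continuous (G \o c)}.
  apply: continuous_comp; first exact: cc.
  exact/differentiable_continuous/smooth_near_differentiable.
rewrite /prop_for /continuous_at (nbhs_singleton fG).
apply: cvg_trans cG; apply: near_eq_cvg.
by apply: filterS fG => q ->.
Qed.

Lemma tangent_chain p v k (f : 'I_k -> M -> R) G h :
  tangent p v -> (forall i, smooth_at p (f i)) ->
  smooth_near (\row_i f i p) G -> (\forall q \near p, h q = G (\row_i f i q)) ->
  v h = \sum_(i < k) 'D_(delta_mx 0 i) G (\row_j f j p) * v (f i).
Proof. by move=> [_]; apply. Qed.

(** A function read in the chart [c] at [p]; the constant 0 if it is not smooth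
    there. *)
Definition chart_rep c p f : 'rV[R]_n -> R :=
  xget (cst 0) [set G | smooth_near (c p) G /\ \forall q \near p, f q = G (c q)].

(** The vector field with constant components [a] in the chart [c]. Functions
    that are not smooth are sent to 0, as a tangent vector requires, because
    they are represented by a constant. *)
Definition coord_field c (a : 'rV[R]_n) : field M :=
  fun p f => 'D_a (chart_rep c p f) (c p).

(** The germ of a representative is unique, because a chart is open. *)
Lemma chart_repE c p f G : is_chart c -> chart_dom c p -> smooth_near (c p) G ->
  (\forall q \near p, f q = G (c q)) -> \forall x \near c p, chart_rep c p f x = G x.
Proof.
move=> cc cp sG fG; rewrite /chart_rep; case: xgetP => [F _ [sF fF]|/(_ G)[]//].
apply: chart_push => //.
by apply: filterS2 fG fF => q -> ->.
Qed.

Lemma coord_fieldE c a p f G : is_chart c -> chart_dom c p ->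
  smooth_near (c p) G -> (\forall q \near p, f q = G (c q)) ->
  coord_field c a p f = 'D_a G (c p).
Proof. by move=> *; apply: near_eq_derive; exact: chart_repE. Qed.

Lemma coord_field_tangent c a p : atlas c -> chart_dom c p ->
  tangent p (coord_field c a p).
Proof.
move=> ac cp; have cc := atlas_chart ac; split=> [f nf|k f G h sf sG hG].
  rewrite /coord_field /chart_rep; case: xgetP => [F _ [sF fF]|_].
    by exfalso; apply: nf; exists c => //; split=> //; exists F.
  exact: derive_cst.
have /choice[F FP] : forall i, exists F : 'rV[R]_n -> R, smooth_near (c p) F /\
    \forall q \near p, f i q = F (c q).
  by move=> i; have [F] := (smooth_atE (f i) ac cp).1 (sf i); exists F.
have Ff : \row_i F i (c p) = \row_i f i p.
  by apply/rowP => i; rewrite !mxE (nbhs_singleton (FP i).2).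
rewrite (@coord_fieldE _ _ _ _ (fun x => G (\row_i F i x)))//.
- rewrite derive_comp_row => [|i|].
  + rewrite Ff; apply: eq_bigr => i _; congr (_ * _).
    by have [? ?] := FP i; rewrite (coord_fieldE _ (G := F i)).
  + by have [/smooth_near_differentiable] := FP i.
  + by rewrite Ff; exact: smooth_near_differentiable.
- apply: smooth_near_comp => [i|]; first by have [] := FP i.
  by rewrite Ff.
- have : \forall q \near p, forall i, f i q = F i (c q).
    by apply: filter_forall => i; exact: (FP i).2.
  apply: filterS2 hG => q -> fF; congr G; apply/rowP => i; rewrite !mxE.
  exact: fF.
Qed.

Lemma coord_field_smooth c a p : atlas c -> chart_dom c p ->
  smooth_field_at p (coord_field c a).
Proof.
move=> ac cp; have cc := atlas_chart ac; split.
  by apply: filterS (chart_near cc cp) => q; exact: coord_field_tangent.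
move=> f /(smooth_atE f ac cp)[G sG fG].
apply/(smooth_atE _ ac cp); exists (fun x => 'D_a G x).
  exact: smooth_near_derive.
near=> q; apply: coord_fieldE => //.
- by near: q; exact: chart_near.
- by near: q; apply: (@chart_pull c p (fun x => smooth_near x G)) => //; exact: smooth_near_near.
- by near: q; exact: near_join.
Unshelve. all: by end_near. Qed.

(** By the chain rule a tangent vector is determined by its action on the
    coordinates, so it extends to a field with constant components. *)
Lemma tangent_extension p v : tangent p v ->
  exists2 X : field M, smooth_field_at p X & X p = v.
Proof.
move=> tv; have [c ac cp] := atlas_cover p; have cc := atlas_chart ac.
pose a := \row_i v (fun q => c q 0 i).
exists (coord_field c a); first exact: coord_field_smooth.
apply/funext => f; have [sf|nf] := pselect (smooth_at p f); last first.
  by rewrite (coord_field_tangent _ ac cp).1// tv.1.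
have [G sG fG] := (smooth_atE f ac cp).1 sf.
rewrite (coord_fieldE _ cc cp sG fG).
rewrite (@tangent_chain p v n (fun i q => c q 0 i) G f)//.
- rewrite chart_row deriveE; last exact: smooth_near_differentiable.
  rewrite [a]row_sum_delta linear_sum; apply: eq_bigr => i _.
  rewrite linearZ/= -deriveE; last exact: smooth_near_differentiable.
  by rewrite mulrC mxE.
- by move=> i; exists c => //; split=> //; exact: atlas_compat.
- by rewrite chart_row.
- by apply: filterS fG => q ->; rewrite chart_row.
Qed.

Lemma smooth_fieldD p (X Y : field M) : smooth_field_at p X ->
  smooth_field_at p Y -> smooth_field_at p (X + Y).
Proof.
move=> [tX sX] [tY sY]; split.
  by apply: filterS2 tX tY => q; exact: tangent_vectorD.
by move=> f sf; apply: smooth_atD; [exact: sX|exact: sY].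
Qed.

Lemma smooth_fieldZ p (a : M -> R) (X : field M) : smooth_at p a ->
  smooth_field_at p X -> smooth_field_at p (fscale a X).
Proof.
move=> sa [tX sX]; split.
  by apply: filterS tX => q; exact: tangent_vectorZ.
by move=> f sf; apply: smooth_atM => //; exact: sX.
Qed.

Lemma smooth_field0 p : smooth_field_at p (0 : field M).
Proof.
split; first by apply: nearW => q; exact: tangent_vector0.
by move=> f _; exact: smooth_at_cst.
Qed.

Lemma smooth_field_sum (I : Type) (s : seq I) (Q : pred I) p (X : I -> field M) :
  (forall i, Q i -> smooth_field_at p (X i)) ->
  smooth_field_at p (\sum_(i <- s | Q i) X i).
Proof.
move=> sX; apply: big_ind => //; first exact: smooth_field0.
by move=> *; exact: smooth_fieldD.
Qed.

Lemma smooth_field_tangent p (X : field M) : smooth_field_at p X -> tangent p (X p).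
Proof. by move=> [/nbhs_singleton]. Qed.

Lemma smooth_field_near p (X : field M) : smooth_field_at p X ->
  \forall q \near p, tangent q (X q).
Proof. by case. Qed.

End Charts.

(** * Smooth functions on the orthonormal frame bundle *)

Section Frames.
Variables (R : realType) (n : nat) (M : manifold R n) (g : bilinear_field M).
Implicit Types (p q : M) (u w : frame M).

(** Two basic neighbourhoods intersect in the one given by the concatenation of
    their lists of generators. *)
Global Instance frame_nbhs_filter u : Filter (frame_nbhs g u).
Proof.
split.
- exists setT, 0%N, (fun=> fun=> 0), setT; split => //.
  + exact: filterT.
  + by case.
  + exact: filterT.
- move=> A B [V [k [phi [N [nV gphi nN sA]]]]] [W [l [psi [P [nW gpsi nP sB]]]]].
  pose chi (i : 'I_(k + l)) := match fintype.split i with inl a => phi a | inr b => psi b end.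
  pose Q := [set x : 'rV[R]_(k + l) | N (\row_i x 0 (lshift l i)) /\
                                       P (\row_i x 0 (rshift k i))].
  have chil w : \row_i (\row_j chi j w) 0 (lshift l i) = \row_i phi i w.
    by apply/rowP => i; rewrite !mxE /chi (unsplitK (inl _)).
  have chir w : \row_i (\row_j chi j w) 0 (rshift k i) = \row_i psi i w.
    by apply/rowP => i; rewrite !mxE /chi (unsplitK (inr _)).
  exists (V `&` W), (k + l)%N, chi, Q; split.
  + exact: filterI.
  + by move=> i; rewrite /chi; case: fintype.split.
  + pose x := \row_j chi j u; apply: filterI.
      apply: (@cvg_row _ _ (nbhs x) _ _ (fun i (y : 'rV[R]_(k + l)) => y 0 (lshift l i)) (fun i => x 0 (lshift l i))).
        by move=> i; exact: coord_continuous.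
      by rewrite chil.
    apply: (@cvg_row _ _ (nbhs x) _ _ (fun i (y : 'rV[R]_(k + l)) => y 0 (rshift k i)) (fun i => x 0 (rshift k i))).
      by move=> i; exact: coord_continuous.
    by rewrite chir.
  + move=> w ow [Vw Ww] [/=]; rewrite chil chir => Nw Pw.
    by split; [exact: sA|exact: sB].
- move=> A B AB [V [k [phi [N [nV gphi nN sA]]]]].
  by exists V, k, phi, N; split => // w ow Vw Nw; exact/AB/sA.
Qed.

(** Neighbourhoods in O(M) constrain orthonormal frames only, so [u] has to be
    one of them. *)
Lemma frame_nbhs_singleton u (A : set (frame M)) :
  orthonormal_frames g u -> frame_nbhs g u A -> A u.
Proof.
move=> ou [V [k [phi [N [nV gphi nN sA]]]]].
by apply: sA => //; exact: nbhs_singleton.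
Qed.

Lemma frame_smooth_generator u phi : frame_generator g u phi -> frame_smooth_at g u phi.
Proof.
move=> gphi; exists 1%N, (fun=> phi), (fun x => x 0 0); split => //.
  exact: smooth_near_coord.
by apply: filterE => w /=; rewrite mxE.
Qed.

Lemma frame_smooth_base u f : smooth_at u.1 f -> frame_smooth_at g u (fun w => f w.1).
Proof. by move=> sf; apply: frame_smooth_generator; left; exists f. Qed.

Lemma frame_smooth_coords u (Y : field M) i : smooth_field_at u.1 Y ->
  frame_smooth_at g u (fun w => frame_coords g Y w i 0).
Proof. by move=> sY; apply: frame_smooth_generator; right; exists i, Y. Qed.

Lemma frame_smooth_comp u m (f : 'I_m -> frame M -> R) G h :
  orthonormal_frames g u ->
  (forall i, frame_smooth_at g u (f i)) -> smooth_near (\row_i f i u) G ->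
  frame_nbhs g u [set w | h w = G (\row_i f i w)] -> frame_smooth_at g u h.
Proof.
move=> ou sf sG hG.
pose D := {k : nat & ('I_k -> frame M -> R) * ('rV[R]_k -> R)}%type.
have /choice[d dP] : forall i, exists d : D,
    [/\ forall j, frame_generator g u ((tagged d).1 j),
        smooth_near (\row_j (tagged d).1 j u) (tagged d).2 &
        frame_nbhs g u [set w | f i w = (tagged d).2 (\row_j (tagged d).1 j w)]].
  by move=> i; have [k [phi [F H]]] := sf i; exists (existT _ k (phi, F)).
(* The generators used by all the [f i] together are indexed by the disjoint
   union of the index sets; [pr i] extracts those that belong to [f i]. *)
pose I := {i : 'I_m & 'I_(tag (d i))}.
pose psi (j : 'I_#|{: I}|) :=
  let t := enum_val j : I in (tagged (d (tag t))).1 (tagged t).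
pose pr i (y : 'rV[R]_#|{: I}|) : 'rV[R]_(tag (d i)) :=
  \row_j y 0 (enum_rank (Tagged (fun i => 'I_(tag (d i))) j : I)).
have prE i w : pr i (\row_j psi j w) = \row_j (tagged (d i)).1 j w.
  by apply/rowP => j; rewrite !mxE /psi enum_rankK.
have fG : frame_nbhs g u [set w | forall i, f i w = (tagged (d i)).2 (pr i (\row_j psi j w))].
  apply: (@filter_forall _ _ (fun i w =>
    f i w = (tagged (d i)).2 (pr i (\row_j psi j w))) (frame_nbhs g u) (frame_nbhs_filter u)) => i; have [_ _] := dP i.
  by apply: filterS => w /=; rewrite prE.
have fu : forall i, f i u = (tagged (d i)).2 (\row_j (tagged (d i)).1 j u).
  by move=> i; have [_ _ /(frame_nbhs_singleton ou)] := dP i.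
exists #|{: I}|, psi, (fun y => G (\row_i (tagged (d i)).2 (pr i y))); split.
- by move=> j; rewrite /psi; have [] := dP (tag (enum_val j : I)).
- apply: smooth_near_comp => [i|].
    apply: smooth_near_comp => [j|]; first exact: smooth_near_coord.
    by rewrite -/(pr i _) prE; have [] := dP i.
  rewrite (_ : \row_i _ = \row_i f i u)//.
  by apply/rowP => i; rewrite !mxE prE fu.
- apply: filterS2 hG fG => w /= -> fw; congr G.
  by apply/rowP => i; rewrite !mxE fw.
Qed.
End Frames.

(** * Local sections of the frame bundle *)

Section LocalFrame.
Variables (R : realType) (n : nat) (M : manifold R n) (g : bilinear_field M).
Hypothesis gM : riemannian_metric g.
Variables (p : M) (S : 'I_n -> field M).
Hypothesis sS : forall i, smooth_field_at p (S i).
Let s (q : M) : frame M := (q, fun i => S i q).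
Hypothesis os : \forall q \near p, orthonormal_frames g (s q).

(** Along the section the coordinates of a field [Y] are the functions g(S_i, Y). *)
Lemma local_frame_generator phi : frame_generator g (s p) phi ->
  smooth_at p (phi \o s).
Proof.
case=> [[f sf ->]//|[i [Y [sY ->]]]].
apply: smooth_at_eq (metric_smooth gM (sS i) sY) _.
by apply: nearW => q; rewrite /= mxE.
Qed.

Lemma local_frame_cvg A : frame_nbhs g (s p) A -> \forall q \near p, A (s q).
Proof.
move=> [V [k [phi [N [nV gphi nN sA]]]]].
have NN : \forall q \near p, N (\row_i phi i (s q)).
  have := @cvg_row _ _ (nbhs p) _ _ (fun i q => phi i (s q)) (fun i => phi i (s p)).
  apply => // i; exact: smooth_at_continuous (local_frame_generator (gphi i)).
near=> q; apply: sA; near: q => //.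
Unshelve. all: by end_near. Qed.

Lemma local_frame_smooth F : frame_smooth_at g (s p) F -> smooth_at p (F \o s).
Proof.
move=> [k [phi [G [gphi sG FG]]]].
apply: (@smooth_at_comp _ _ _ p k (fun i => phi i \o s) G) => //.
  by move=> i; exact: local_frame_generator.
exact: local_frame_cvg FG.
Qed.

(** The image of [v] under the differential of the local section [s] of O(M); it
    is set to 0 on functions that are not smooth, as a tangent vector requires. *)
Definition frame_pushforward (v : operator R M) : operator R (frame M) :=
  fun F => if `[< frame_smooth_at g (s p) F >] then v (F \o s) else 0.

Lemma frame_pushforwardE v F : frame_smooth_at g (s p) F -> frame_pushforward v F = v (F \o s).
Proof. by move=> sF; rewrite /frame_pushforward asboolT. Qed.

(** A section with values in [Q] has its differential tangent to [Q]. *)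
Lemma frame_pushforward_tangent v (Q : set (frame M)) : tangent p v ->
  (\forall q \near p, Q (s q)) -> tangent_sub g Q (s p) (frame_pushforward v).
Proof.
move=> tv sQ; have op := nbhs_singleton os; split; last first.
  move=> F sF /local_frame_cvg F0; rewrite frame_pushforwardE//.
  apply: (tangent_vector_cst tv (a := 0)).
  by apply: filterS2 sQ F0 => q Qq; exact.
split=> [F nF|k f G h sf sG hG]; first by rewrite /frame_pushforward asboolF.
rewrite frame_pushforwardE; last exact: frame_smooth_comp hG.
rewrite (@tangent_chain _ _ _ p v k (fun i => f i \o s) G)//.
- by apply: eq_bigr => i _; rewrite frame_pushforwardE.
- by move=> i; exact: local_frame_smooth.
- exact: local_frame_cvg hG.
Qed.

Lemma frame_pushforward_over v : lies_over (s p) (frame_pushforward v) v.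
Proof. by move=> f sf; rewrite frame_pushforwardE//; exact: frame_smooth_base. Qed.

End LocalFrame.

(** * Gram-Schmidt orthonormalization of local fields *)

Section MetricAlgebra.
Variables (R : realType) (n : nat) (M : manifold R n) (g : bilinear_field M).
Hypothesis gM : riemannian_metric g.
Implicit Types (p q : M) (v w z : operator R M).

Lemma tangentD p v w : tangent p v -> tangent p w -> tangent p (v + w).
Proof. exact: tangent_vectorD. Qed.

Lemma tangentZ p (a : R) v : tangent p v -> tangent p (a *: v).
Proof. exact: tangent_vectorZ. Qed.

Lemma tangent0 p : tangent p (0 : operator R M).
Proof. exact: tangent_vector0. Qed.

Lemma tangent_sum (I : Type) (s : seq I) (Q : pred I) p (v : I -> operator R M) :
  (forall i, tangent p (v i)) -> tangent p (\sum_(i <- s | Q i) v i).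
Proof.
move=> tv; apply: big_ind => //; first exact: tangent0.
by move=> *; exact: tangentD.
Qed.

Lemma metric0 p z : tangent p z -> g p 0 z = 0.
Proof.
move=> tz; have := metric_linear gM 1 (tangent0 p) (tangent0 p) tz.
by rewrite scaler0 addr0 mul1r => /(congr1 (fun x => x - g p 0 z)); rewrite subrr addrK.
Qed.

Lemma metricD p v w z : tangent p v -> tangent p w -> tangent p z ->
  g p (v + w) z = g p v z + g p w z.
Proof.
by move=> tv tw tz; have := metric_linear gM 1 tv tw tz; rewrite scale1r mul1r.
Qed.

Lemma metricZ p (a : R) v z : tangent p v -> tangent p z ->
  g p (a *: v) z = a * g p v z.
Proof.
move=> tv tz; have := metric_linear gM a tv (tangent0 p) tz.
by rewrite addr0 metric0// addr0.
Qed.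

Lemma metric_suml (I : Type) (s : seq I) (Q : pred I) p (v : I -> operator R M) z :
  (forall i, tangent p (v i)) -> tangent p z ->
  g p (\sum_(i <- s | Q i) v i) z = \sum_(i <- s | Q i) g p (v i) z.
Proof.
move=> tv tz; elim: s => [|i s IH]; first by rewrite !big_nil metric0.
rewrite !big_cons; case: (Q i) => //.
by rewrite metricD// ?IH//; exact: tangent_sum.
Qed.

Lemma metricZr p (a : R) v z : tangent p v -> tangent p z ->
  g p v (a *: z) = a * g p v z.
Proof.
move=> tv tz; rewrite (Defs.metric_sym gM tv (tangentZ a tz)) metricZ//.
by rewrite (Defs.metric_sym gM tz tv).
Qed.

End MetricAlgebra.

Section GramSchmidt.
Variables (R : realType) (n : nat) (M : manifold R n).
Variables (P : endo_field M) (g : bilinear_field M).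
Hypothesis gM : riemannian_metric g.
Hypothesis PL : forall p a v w, tangent p v -> tangent p w ->
    P p (a *: v + w) = a *: P p v + P p w.
Hypothesis Pg : forall p v w, tangent p v -> tangent p w ->
    g p (P p v) (P p w) = g p v w.
Implicit Types (p q : M) (v w z : operator R M).

Lemma endo0 p : P p 0 = 0.
Proof.
have := PL 1 (tangent0 p) (tangent0 p).
by rewrite scaler0 addr0 scale1r => /(congr1 (fun x => x - P p 0)); rewrite subrr addrK.
Qed.

Lemma endoD p v w : tangent p v -> tangent p w -> P p (v + w) = P p v + P p w.
Proof. by move=> tv tw; have := PL 1 tv tw; rewrite !scale1r. Qed.

Lemma endoZ p (a : R) v : tangent p v -> P p (a *: v) = a *: P p v.
Proof. by move=> tv; have := PL a tv (tangent0 p); rewrite endo0 !addr0. Qed.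

Lemma endo_sum (I : Type) (s : seq I) (Q : pred I) p (v : I -> operator R M) :
  (forall i, tangent p (v i)) ->
  P p (\sum_(i <- s | Q i) v i) = \sum_(i <- s | Q i) P p (v i).
Proof.
move=> tv; elim: s => [|i s IH]; first by rewrite !big_nil endo0.
rewrite !big_cons; case: (Q i) => //.
by rewrite endoD// ?IH//; exact: tangent_sum.
Qed.

Variable e : 'I_n -> R.
Hypothesis e2 : forall i, e i * e i = 1.

(** Eigenvectors of [P] for distinct eigenvalues are orthogonal, so that
    subtracting the projections on earlier vectors stays in the eigenspace. *)
Lemma gram_schmidt_step q m v (s : 'I_n -> operator R M) i :
  tangent q v -> (forall j, tangent q (s j)) ->
  (forall j k : 'I_n, (j < m)%N -> (k < m)%N -> g q (s j) (s k) = (j == k)%:R) ->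
  P q v = e i *: v -> (forall j : 'I_n, (j < m)%N -> P q (s j) = e j *: s j) ->
  let w := v + \sum_(j < n | (j < m)%N) - g q v (s j) *: s j in
  (forall j : 'I_n, (j < m)%N -> g q w (s j) = 0) /\ P q w = e i *: w.
Proof.
move=> tv ts os Pv Ps w; split.
  move=> j jm; rewrite /w metricD//; last first.
    by apply: tangent_sum => k; exact: tangentZ.
  rewrite metric_suml// => [|k]; last exact: tangentZ.
  rewrite (bigD1 j)//= big1 => [|k /andP[km kj]].
    by rewrite metricZ// os// eqxx mulr1 addr0 subrr.
  by rewrite metricZ// os// (negPf kj) mulr0.
rewrite /w endoD//; last by apply: tangent_sum => k; exact: tangentZ.
rewrite endo_sum// => [|k]; last exact: tangentZ.
rewrite scalerDr Pv; congr (_ + _); rewrite scaler_sumr; apply: eq_bigr => j jm.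
rewrite endoZ// Ps// !scalerA; congr (_ *: _).
have : g q v (s j) = e i * e j * g q v (s j).
  rewrite -[in LHS]Pg// Pv Ps// metricZ//; last exact: tangentZ.
  by rewrite metricZr// mulrA.
by move=> {1}->; rewrite mulNr mulrN mulrAC -(mulrA (e i)) e2 mulr1.
Qed.

(** Orthonormalization of local fields that are independent at [p]. The
    coefficients [c] record that the span at [p] does not grow, which keeps the
    next vector out of it. *)
Lemma gram_schmidt p (E : 'I_n -> field M) :
  (forall i, smooth_field_at p (E i)) ->
  (forall i, \forall q \near p, P q (E i q) = e i *: E i q) ->
  (forall c : 'I_n -> R, \sum_i c i *: E i p = 0 -> forall i, c i = 0) ->
  forall m, (m <= n)%N -> exists S : 'I_n -> field M,
  [/\ forall i, smooth_field_at p (S i),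
      \forall q \near p, forall i j : 'I_n, (i < m)%N -> (j < m)%N ->
        g q (S i q) (S j q) = (i == j)%:R,
      \forall q \near p, forall i : 'I_n, (i < m)%N -> P q (S i q) = e i *: S i q &
      forall i : 'I_n, (i < m)%N -> exists c : 'I_n -> R,
        (forall j : 'I_n, (m <= j)%N -> c j = 0) /\ S i p = \sum_j c j *: E j p].
Proof.
move=> sE PE indep; elim=> [_|m IH mn].
  by exists E; split => //; exact: nearW.
have [S [sS oS PS spanS]] := IH (ltnW mn).
pose i0 := Ordinal mn.
pose F : field M := E i0 +
  \sum_(j < n | (j < m)%N) fscale (fun q => - g q (E i0 q) (S j q)) (S j).
have FE q : F q = E i0 q + \sum_(j < n | (j < m)%N) - g q (E i0 q) (S j q) *: S j q.
  by rewrite /F -[LHS]/(E i0 q + (\sum_(j < n | (j < m)%N) _) q) fct_sumE.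
have sF : smooth_field_at p F.
  apply: smooth_fieldD => //; apply: smooth_field_sum => j _.
  apply: smooth_fieldZ => //.
  apply: smooth_at_eq (smooth_atM (smooth_at_cst _ (-1)) (metric_smooth gM (sE i0) (sS j))) _.
  by apply: nearW => q; rewrite mulN1r.
(* [F p] is the next vector minus a combination of the earlier ones, so its own
   coefficient is 1 and independence forbids it to vanish. *)
have [d [dF d1 d0]] : exists d : 'I_n -> R,
    [/\ F p = \sum_k d k *: E k p, d i0 = 1 & forall k : 'I_n, (m < k)%N -> d k = 0].
  have /choice[c cP] : forall j : 'I_n, exists c : 'I_n -> R, (j < m)%N ->
      (forall k : 'I_n, (m <= k)%N -> c k = 0) /\ S j p = \sum_k c k *: E k p.
    move=> j; case: (ltnP j m) => [/spanS[c cP]|_]; first by exists c.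
    by exists (fun=> 0).
  exists (fun k => (k == i0)%:R +
    \sum_(j < n | (j < m)%N) - g p (E i0 p) (S j p) * c j k); split.
  - under [RHS]eq_bigr do rewrite scalerDl scaler_suml.
    rewrite big_split/= FE; congr (_ + _).
      rewrite (bigD1 i0)//= eqxx scale1r big1 ?addr0// => k /negPf ->.
      by rewrite scale0r.
    rewrite exchange_big; apply: eq_bigr => j jm.
    rewrite (cP j jm).2 [in LHS]scaler_sumr; apply: eq_bigr => k _.
    by rewrite scalerA -(cP j jm).2.
  - rewrite eqxx big1 ?addr0// => j jm.
    by rewrite (cP j jm).1// mulr0.
  - move=> k mk; rewrite (_ : (k == i0) = false) ?add0r; last first.
      by apply/eqP => ki; rewrite ki ltnn in mk.
    by rewrite big1// => j jm; rewrite (cP j jm).1 ?mulr0// ltnW.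
have Fp0 : F p != 0.
  apply/eqP => F0; have := indep d; rewrite -dF => /(_ F0 i0).
  by rewrite d1 => /eqP; rewrite oner_eq0.
pose r q := g q (F q) (F q).
have sr : smooth_at p r by exact: metric_smooth.
have rp : 0 < r p by apply: metric_pos => //; exact: smooth_field_tangent.
pose a q := r q `^ (- 2^-1).
pose T := fscale a F.
pose S' i := if i == i0 then T else S i.
have S'i0 : S' i0 = T by rewrite /S' eqxx.
have S'lt (i : 'I_n) : (i < m)%N -> S' i = S i :> field M.
  by rewrite /S'; case: eqP => // ->; rewrite ltnn.
have lt_case (i : 'I_n) : (i < m.+1)%N -> i = i0 \/ (i < m)%N.
  by rewrite ltnS leq_eqVlt => /orP[/eqP im|]; [left; exact: val_inj|right].
have sT : smooth_field_at p T by apply: smooth_fieldZ => //; exact: smooth_at_powR.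
have tE := smooth_field_near (sE i0).
have tF := smooth_field_near sF.
have tS : \forall q \near p, forall j, tangent q (S j q).
  by apply: filter_forall => j; exact: smooth_field_near.
have rpos : \forall q \near p, 0 < r q.
  exact: (cvgr_gt (r p) (smooth_at_continuous sr)) rp.
have FS : \forall q \near p, (forall j : 'I_n, (j < m)%N -> g q (F q) (S j q) = 0) /\
    P q (F q) = e i0 *: F q.
  near=> q; rewrite FE; apply: gram_schmidt_step.
  - by near: q.
  - by near: q.
  - by near: q.
  - by near: q; exact: PE.
  - by near: q.
exists S'; split.
- by move=> i; rewrite /S'; case: ifP.
- near=> q => i j.
  have [FS0 _] : (forall j : 'I_n, (j < m)%N -> g q (F q) (S j q) = 0) /\
    P q (F q) = e i0 *: F q by near: q.
  have tFq : tangent q (F q) by near: q.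
  have tSq : forall j, tangent q (S j q) by near: q.
  have rq : 0 < r q by near: q.
  move=> /lt_case[->|im] /lt_case[->|jm]; rewrite ?S'i0 ?(S'lt _ im) ?(S'lt _ jm).
  + rewrite eqxx metricZ//; last exact: tangentZ.
    rewrite metricZr// -/(r q) mulrA -powRD.
      by rewrite -opprD -[2^-1]mul1r -splitr powR_inv1 ?ltW// mulVf// gt_eqF.
    by rewrite (gt_eqF rq) implybT.
  + rewrite metricZ// FS0// mulr0 (_ : (i0 == j) = false)//.
    by apply/eqP => ij; rewrite -ij ltnn in jm.
  + rewrite metricZr// Defs.metric_sym// FS0// mulr0 (_ : (i == i0) = false)//.
    by apply/eqP => ij; rewrite ij ltnn in im.
  + by move: i j im jm; near: q.
- near=> q => i /lt_case[->|im]; rewrite ?S'i0 ?(S'lt _ im).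
  + rewrite endoZ; last by near: q.
    have [_ ->] : (forall j : 'I_n, (j < m)%N -> g q (F q) (S j q) = 0) /\
      P q (F q) = e i0 *: F q by near: q.
    by rewrite !scalerA mulrC.
  + by move: i im; near: q.
- move=> i /lt_case[->|im]; rewrite ?S'i0 ?(S'lt _ im).
    exists (fun k => a p * d k); split => [k mk|]; first by rewrite d0// mulr0.
    rewrite -[LHS]/(a p *: F p) dF scaler_sumr.
    by apply: eq_bigr => k _; rewrite scalerA.
  have [c [c0 cE]] := spanS i im; exists c; split => // j mj.
  by rewrite c0// ltnW.
Unshelve. all: by end_near. Qed.

End GramSchmidt.

(** * Adapted local frames *)

Section BlockSign.
Variables (R : realType) (n1 n2 : nat).

Definition block_sign (i : 'I_(n1 + n2)) : R :=
  if fintype.split i is inl _ then 1 else -1.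

Definition sign_mx : 'M[R]_(n1 + n2) := block_mx 1%:M 0 0 (-1)%:M.

Lemma block_sign2 i : block_sign i * block_sign i = 1.
Proof. by rewrite /block_sign; case: fintype.split => _; rewrite ?mulr1// mulrNN mulr1. Qed.

Lemma block_sign_lshift j : block_sign (lshift n2 j) = 1.
Proof. by rewrite /block_sign (unsplitK (inl j)). Qed.

Lemma block_sign_rshift j : block_sign (rshift n1 j) = -1.
Proof. by rewrite /block_sign (unsplitK (inr j)). Qed.

Lemma sign_mxE : sign_mx = diag_mx (\row_i block_sign i).
Proof.
apply/matrixP => i j; rewrite /sign_mx.
case: (split_ordP i) => k ->; case: (split_ordP j) => l ->.
- by rewrite block_mxEul !mxE block_sign_lshift eq_lshift.
- by rewrite block_mxEur !mxE eq_lrshift.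
- by rewrite block_mxEdl !mxE eq_rlshift.
- by rewrite block_mxEdr !mxE block_sign_rshift eq_rshift.
Qed.

Lemma mul_sign_mx m (A : 'M[R]_(n1 + n2, m)) i j :
  (sign_mx *m A) i j = block_sign i * A i j.
Proof. by rewrite sign_mxE mul_diag_mx !mxE. Qed.

Lemma mul_mx_sign m (A : 'M[R]_(m, n1 + n2)) i j :
  (A *m sign_mx) i j = A i j * block_sign j.
Proof. by rewrite sign_mxE mul_mx_diag !mxE. Qed.

Lemma sign_mx2 : sign_mx *m sign_mx = 1%:M.
Proof.
apply/matrixP => i j; rewrite mul_sign_mx sign_mxE !mxE mulrnAr.
by case: eqP => [->|] //; rewrite block_sign2.
Qed.

Lemma tr_sign_mx : sign_mx^T = sign_mx.
Proof. by rewrite sign_mxE tr_diag_mx. Qed.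

End BlockSign.

Lemma half_involution (F : numFieldType) (V : lmodType F) (a : F) (v : V) :
  a * a = 1 -> 2^-1 *: (v + a *: (a *: v)) = v.
Proof.
by move=> a2; rewrite scalerA a2 scale1r -mulr2n -[v *+ 2]scaler_nat scalerA mulVf ?scale1r//.
Qed.

Section AdaptedFrames.
Variables (R : realType) (n1 n2 : nat) (M : manifold R (n1 + n2)).
Variables (P : endo_field M) (g : bilinear_field M).
Hypothesis apr : almost_product_riemannian P g n1 n2.
Let gM := ap_metric apr.
Let PT := ap_tangent apr.
Let PL := ap_linear apr.
Let Pg := ap_isometry apr.
Let e := @block_sign R n1 n2.
Implicit Types (p q : M) (v w : operator R M).

(** For a = 1 and a = -1 the vector on which [P] acts is the image of [v] under
    [pi1] and [pi2]. *)
Lemma eigenprojection q v a : a * a = 1 -> tangent q v ->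
  P q (2^-1 *: (v + a *: P q v)) = a *: (2^-1 *: (v + a *: P q v)).
Proof.
move=> a2 tv; have tP := PT tv.
rewrite (endoZ PL); last by apply: tangentD => //; exact: tangentZ.
rewrite (endoD PL)//; last exact: tangentZ.
rewrite (endoZ PL)// (ap_square apr)// !scalerDr !scalerA addrC; congr (_ + _).
  by rewrite mulrC.
by rewrite mulrAC a2 mul1r.
Qed.

Lemma unique_coords_free k (S : set (operator R M)) (b : 'I_k -> operator R M)
    (d : 'I_k -> R) :
  (forall v, S v -> exists! c : 'rV[R]_k, v = \sum_(i < k) c 0 i *: b i) ->
  S 0 -> \sum_i d i *: b i = 0 -> forall i, d i = 0.
Proof.
move=> US /US[c [_ cU]] d0 i.
have c0 : c = 0 by apply: cU; rewrite big1// => j _; rewrite mxE scale0r.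
have : c = \row_j d j by apply: cU; rewrite -[LHS]d0; apply: eq_bigr => j _; rewrite mxE.
by rewrite c0 => /rowP/(_ i); rewrite !mxE.
Qed.

(** The eigenspaces of [P] at [p] are in direct sum, so bases of the two form a
    basis of eigenvectors. *)
Lemma eigenbasis p : exists b : 'I_(n1 + n2) -> operator R M,
  [/\ forall i, tangent p (b i), forall i, P p (b i) = e i *: b i &
      forall c : 'I_(n1 + n2) -> R, \sum_i c i *: b i = 0 -> forall i, c i = 0].
Proof.
have [b1 S1 U1] := ap_rank1 apr p; have [b2 S2 U2] := ap_rank2 apr p.
have T1 i : tangent p (b1 i) /\ P p (b1 i) = b1 i.
  have [v tv <-] := S1 i; have tP := PT tv; split.
    by apply: tangentZ; exact: tangentD.
  have := eigenprojection (mulr1 1) tv.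
  by rewrite !scale1r.
have T2 i : tangent p (b2 i) /\ P p (b2 i) = - b2 i.
  have [v tv <-] := S2 i; have tP := PT tv; split.
    by apply: tangentZ; rewrite -scaleN1r; apply: tangentD => //; exact: tangentZ.
  have := @eigenprojection p v (-1) _ tv; rewrite mulrNN mulr1 => /(_ erefl).
  by rewrite !scaleN1r.
exists (fun i => match fintype.split i with inl j => b1 j | inr j => b2 j end); split.
- by move=> i; case: fintype.split => j; [have [] := T1 j|have [] := T2 j].
- move=> i; rewrite /e /block_sign; case: fintype.split => j.
    by rewrite scale1r; have [] := T1 j.
  by rewrite scaleN1r; have [] := T2 j.
move=> c; rewrite big_split_ord/=.
under eq_bigr do rewrite (unsplitK (inl _)).
under [X in _ + X]eq_bigr do rewrite (unsplitK (inr _)).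
set s1 := (X in X + _ = _); set s2 := (X in _ + X = _) => s12.
have ts1 : tangent p s1 by apply: tangent_sum => j; apply: tangentZ; have [] := T1 j.
have ts2 : tangent p s2 by apply: tangent_sum => j; apply: tangentZ; have [] := T2 j.
have Ps1 : P p s1 = s1.
  rewrite (endo_sum PL) => [|j]; last by apply: tangentZ; have [] := T1 j.
  by apply: eq_bigr => j _; have [tj Pj] := T1 j; rewrite (endoZ PL)// Pj.
have Ps2 : P p s2 = - s2.
  rewrite (endo_sum PL) => [|j]; last by apply: tangentZ; have [] := T2 j.
  by rewrite -sumrN; apply: eq_bigr => j _; have [tj Pj] := T2 j; rewrite (endoZ PL)// Pj scalerN.
(* Applying [P] to s1 + s2 = 0. *)
have s12' : s1 - s2 = 0.
  by rewrite -Ps1 -Ps2 -(endoD PL)// s12 (endo0 PL).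
have s10 : s1 = 0.
  have : s1 + s1 = 0 by rewrite -{1}[s1](addrK s2) s12 sub0r addrC.
  rewrite -mulr2n -scaler_nat => /eqP; rewrite scaler_eq0 pnatr_eq0/=.
  by move=> /eqP.
have s20 : s2 = 0 by move: s12; rewrite s10 add0r.
have z1 : (pi1 P p @` tangent p) 0.
  exists 0; first exact: tangent0.
  by rewrite /pi1 (endo0 PL) addr0 scaler0.
have z2 : (pi2 P p @` tangent p) 0.
  exists 0; first exact: tangent0.
  by rewrite /pi2 (endo0 PL) subr0 scaler0.
move=> i; case: (split_ordP i) => j ->.
  exact: (unique_coords_free U1 z1 (d := fun j => c (lshift n2 j))).
exact: (unique_coords_free U2 z2 (d := fun j => c (rshift n1 j))).
Qed.

(** Projecting local extensions of an eigenbasis to the eigenbundles leaves their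
    values at [p] unchanged, so they stay independent there and can be
    orthonormalized within the eigenbundles. *)
Lemma adapted_local_frame p : exists S : 'I_(n1 + n2) -> field M,
  (forall i, smooth_field_at p (S i)) /\
  \forall q \near p, adapted_frames g P (q, fun i => S i q).
Proof.
have [b [tb Pb indep]] := eigenbasis p.
have /choice[X XP] : forall i, exists X : field M, smooth_field_at p X /\ X p = b i.
  by move=> i; have [X] := tangent_extension (tb i); exists X.
pose E i : field M :=
  fscale (fun=> 2^-1) (X i + fscale (fun=> e i) (app P (X i))).
have sX i : smooth_field_at p (X i) by have [] := XP i.
have Ep i : E i p = b i.
  rewrite /E -[LHS]/(2^-1 *: (X i p + e i *: P p (X i p))) (XP i).2 Pb.
  exact/half_involution/block_sign2.
have [|i|c|S [sS oS PS _]] := @gram_schmidt R _ M P g gM PL Pg e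
    (@block_sign2 R n1 n2) p E _ _ _ (n1 + n2) (leqnn _).
- move=> i; apply: smooth_fieldZ; first exact: smooth_at_cst.
  apply: smooth_fieldD => //; apply: smooth_fieldZ; first exact: smooth_at_cst.
  exact: (ap_smooth apr).
- apply: filterS (smooth_field_near (sX i)) => q tq.
  by apply: eigenprojection => //; exact: block_sign2.
- by under eq_bigr do rewrite Ep; exact: indep.
exists S; split => //.
have tS : \forall q \near p, forall j, tangent q (S j q).
  by apply: filter_forall => j; exact: smooth_field_near.
near=> q; have tSq : forall j, tangent q (S j q) by near: q.
split.
  split => //= i j.
  have H : forall i j : 'I_(n1 + n2), (i < n1 + n2)%N -> (j < n1 + n2)%N ->
        g q (S i q) (S j q) = (i == j)%:R by near: q.
  exact: H.
have H : forall i : 'I_(n1 + n2), (i < n1 + n2)%N -> P q (S i q) = e i *: S i q by near: q.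
move=> x; rewrite /frame_map/= (endo_sum PL) => [|i]; last exact: tangentZ.
apply: eq_bigr => i _; rewrite (endoZ PL)// H// scalerA; congr (_ *: _).
by rewrite mul_sign_mx mulrC.
Unshelve. all: by end_near. Qed.

End AdaptedFrames.

(** * The Lie algebra of O(n) *)

Section OrthogonalLie.
Variable R : realType.

Lemma is_derive_entry m n (a : R -> 'M[R]_(m, n)) A (t : R) i j :
  is_derive t (1 : R) a A -> is_derive t (1 : R) (fun s => a s i j) (A i j).
Proof.
move=> [da DA]; split; first exact: (derivable_mxP _ _ _).1.
by move: DA; rewrite derive_mx// => <-; rewrite mxE.
Qed.

Lemma is_derive0_affine (f u : R -> R) (c l : R) :
  (forall t, f t = c + t * u t) -> u t @[t --> (0 : R)] --> l ->
  is_derive (0 : R) (1 : R) f l.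
Proof.
move=> fE ul.
have H : h^-1 *: ((f \o shift 0) (h *: 1) - f 0) @[h --> 0^'] --> l.
  apply: cvg_trans (cvg_trans (cvg_app u (@cvg_within _ _ _ _)) ul).
  apply: near_eq_cvg; near=> h.
  have h0 : h != 0 by near: h; exact: nbhs_dnbhs_neq.
  rewrite /= addr0 !fE mul0r addr0 addrAC subrr add0r.
  by rewrite -[_ *: 1]/(_ * 1) mulr1 -[_ *: _]/(_ * _) mulKf.
by split; [apply/cvg_ex; exists l|exact/cvg_lim].
Unshelve. all: by end_near. Qed.

(** Differentiating (a^T a) i j = (i == j) at the identity. *)
Lemma lie_On_antisym n (A : 'M[R]_n) : lie_algebra (@in_On R n) A -> A^T = - A.
Proof.
move=> [a [oa a0 da]]; apply/matrixP => i j; rewrite !mxE.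
pose h (k : 'I_n) : R -> R := (fun t => a t k i) * (fun t => a t k j).
have dh k : is_derive (0 : R) (1 : R) (h k) ((k == i)%:R * A k j + (k == j)%:R * A k i).
  have := is_deriveM (is_derive_entry k i da) (is_derive_entry k j da).
  by rewrite a0 !mxE.
have sh : \sum_(k < n) h k = cst ((i == j)%:R).
  apply/funext => t; rewrite fct_sumE.
  by have /matrixP/(_ i j) := oa t; rewrite !mxE => <-; apply: eq_bigr => k _; rewrite mxE.
have [_] := is_derive_sum dh; rewrite sh derive_cst big_split/=.
rewrite (bigD1 i)//= eqxx mul1r big1 ?addr0; last by move=> k /negPf ->; rewrite mul0r.
rewrite (bigD1 j)//= eqxx mul1r big1 ?addr0; last by move=> k /negPf ->; rewrite mul0r.
by move/esym/eqP; rewrite addrC addr_eq0 => /eqP.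
Qed.

(** An antisymmetric form vanishes on the diagonal: v C v^T = 0, so v = t v C
    forces v v^T = 0. *)
Lemma antisym_unitmx n (C : 'M[R]_n) (t : R) : C^T = - C -> 1%:M - t *: C \in unitmx.
Proof.
move=> aC; rewrite -row_free_unit; apply: inj_row_free => v.
rewrite mulmxBr mulmx1 -scalemxAr => /eqP; rewrite subr_eq0 => /eqP vC.
have q0 : v *m C *m v^T = 0.
  apply/matrixP => i j; rewrite !ord1 [RHS]mxE.
  have : (v *m C *m v^T)^T 0 0 = - (v *m C *m v^T) 0 0.
    by rewrite !trmx_mul trmxK aC mulNmx mulmxN mxE mulmxA.
  rewrite mxE => /eqP; rewrite -addr_eq0 -mulr2n mulrn_eq0/= => /eqP //.
have : v *m v^T = 0 by rewrite {1}vC -scalemxAl q0 scaler0.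
move=> /matrixP/(_ 0 0); rewrite !mxE => /eqP.
under eq_bigr do rewrite mxE -expr2.
rewrite psumr_eq0 => [|i _]; last exact: sqr_ge0.
move=> /allP v0; apply/rowP => i; rewrite mxE; apply/eqP.
by have := v0 i (mem_index_enum _); rewrite sqrf_eq0.
Qed.

(** A curve in O(n) that is defined for all times and has velocity [C] at 0: a
    rational counterpart of exp (t C), parametrized to have the same velocity. *)
Definition cayley n (C : 'M[R]_n) (t : R) : 'M[R]_n :=
  invmx (1%:M - (t / 2) *: C) *m (1%:M + (t / 2) *: C).

Lemma cayley_comm n (C : 'M[R]_n) (s : R) :
  (1%:M - s *: C) *m (1%:M + s *: C) = (1%:M + s *: C) *m (1%:M - s *: C).
Proof.
rewrite !(mulmxDl, mulmxDr, mulNmx, mulmxN, mulmx1, mul1mx) !addrA.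
by rewrite addrK addrNK.
Qed.

Lemma cayley_On n (C : 'M[R]_n) t : C^T = - C -> in_On (cayley C t).
Proof.
move=> aC; rewrite /in_On/= /cayley; set s := t / 2.
have uB := antisym_unitmx s aC; have uB' := antisym_unitmx (- s) aC.
rewrite scaleNr opprK in uB'.
set B := 1%:M - s *: C in uB *; set B' := 1%:M + s *: C in uB' *.
have trB : B^T = B' by rewrite /B /B' linearB/= trmx1 linearZ/= aC scalerN opprK.
have trB' : B'^T = B by rewrite -trB trmxK.
rewrite trmx_mul trmx_inv trB trB' mulmxA -(mulmxA B) -(mulmxA B).
have -> : invmx B' *m invmx B = invmx B *m invmx B'.
  apply: (can_inj (mulKmx uB)); rewrite mulKVmx//.
  apply: (can_inj (mulKmx uB')); rewrite mulmxV// !mulmxA -cayley_comm -/B -/B'.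
  by rewrite mulmxK// mulmxV.
by rewrite -(mulmxA (invmx B)) mulVmx// mulmx1 mulmxV.
Qed.

Lemma cayley0 n (C : 'M[R]_n) : cayley C 0 = 1%:M.
Proof. by rewrite /cayley mul0r scale0r subr0 addr0 invmx1 mulmx1. Qed.

Lemma On_entry_le1 n (a : 'M[R]_n) i j : in_On a -> `|a i j| <= 1.
Proof.
move=> /matrixP/(_ j j); rewrite !mxE eqxx mulr1n => sa.
rewrite -(@expr_le1 _ 2)// real_normK ?num_real// -sa.
rewrite (bigD1 i)//= mxE -expr2 lerDl; apply: sumr_ge0 => k _.
by rewrite mxE -expr2 sqr_ge0.
Qed.

(** From (1 - tC/2) a(t) = 1 + tC/2 one gets a(t) = 1 + t C (1 + a(t))/2; as
    orthogonal matrices are bounded this gives first the continuity, then the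
    derivative of [a] at 0. *)
Lemma cayley_derive n (C : 'M[R]_n) : C^T = - C ->
  is_derive (0 : R) (1 : R) (cayley C) C.
Proof.
move=> aC; pose u i j t := 2^-1 * (C *m (1%:M + cayley C t)) i j.
have aE i j t : cayley C t i j = (1%:M : 'M[R]_n) i j + t * u i j t.
  have : (1%:M - (t / 2) *: C) *m cayley C t = 1%:M + (t / 2) *: C.
    by rewrite /cayley mulKVmx// antisym_unitmx.
  rewrite mulmxBl mul1mx => /eqP; rewrite subr_eq => /eqP ->.
  rewrite /u mulrA -[RHS]/(_ + _) mulmxDr mulmx1 -scalemxAl -addrA -scalerDr.
  by rewrite mxE [X in _ + X]mxE.
have ca i j : cayley C t i j @[t --> (0 : R)] --> (1%:M : 'M[R]_n) i j.
  (* The entries of an orthogonal matrix are at most 1 in absolute value. *)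
  pose K := 2^-1 * \sum_k `|C i k| * 2.
  have uK t : `|u i j t| <= K.
    rewrite /u /K normrM ger0_norm ?invr_ge0// ler_pM2l ?invr_gt0//.
    rewrite mxE (le_trans (ler_norm_sum _ _ _))//; apply: ler_sum => k _.
    rewrite normrM ler_wpM2l// mxE (le_trans (ler_normD _ _))//.
    rewrite [leRHS](_ : 2 = 1 + 1)// lerD//; last exact/On_entry_le1/cayley_On.
    by rewrite mxE; case: eqP; rewrite ?mulr1n ?mulr0n ?normr0 ?normr1.
  rewrite (eq_cvg _ _ (aE i j)).
  have tu0 : t * u i j t @[t --> (0 : R)] --> (0 : R).
    apply/norm_cvg0P.
    apply: (@squeeze_cvgr _ _ _ _ (fun=> 0) (fun t : R => `|t| * K)).
    - by apply: nearW => t; apply/andP; split => //; rewrite normrM ler_wpM2l.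
    - exact: cvg_cst.
    - have H : `|t| * K @[t --> (0 : R)] --> `|0 : R| * K.
        by apply: cvgMr_tmp; exact: norm_continuous.
      by rewrite normr0 mul0r in H.
  have := cvgD (cvg_cst ((1%:M : 'M[R]_n) i j)) tu0.
  by rewrite addr0 => H; exact: H.
have du i j : is_derive (0 : R) (1 : R) (fun t => cayley C t i j) (C i j).
  apply: (is_derive0_affine (aE i j)).
  have uE t : u i j t = 2^-1 *
      \sum_k C i k * ((1%:M : 'M[R]_n) k j + cayley C t k j).
    by rewrite /u mxE; under eq_bigr do rewrite [X in _ * X]mxE.
  rewrite (eq_cvg _ _ uE).
  have <- : 2^-1 * (\sum_k C i k * ((1%:M : 'M[R]_n) k j + (1%:M : 'M[R]_n) k j)) = C i j.
    rewrite (bigD1 j)//= big1 => [|k kj]; last by rewrite mxE (negPf kj) addr0 mulr0.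
    by rewrite mxE eqxx addr0 mulrCA -mulr2n mulVf ?mulr1// pnatr_eq0.
  apply: cvgMl_tmp; apply: cvg_big => [|k _]; first exact: add_continuous.
  by apply: cvgMl_tmp; apply: cvgD; [exact: cvg_cst|exact: ca].
have da : derivable (cayley C) 0 1.
  by apply/derivable_mxP => i j; have [] := du i j.
split => //; apply/matrixP => i j; rewrite derive_mx// mxE.
by have [_] := du i j.
Qed.

End OrthogonalLie.

(** * The Lie algebra of O(n1) x O(n2) *)

Section BlockLie.
Variables (R : realType) (n1 n2 : nat).
Local Notation J := (sign_mx R n1 n2).
Implicit Types (a A B C : 'M[R]_(n1 + n2)).

(** O(n1) x O(n2) is the centralizer of [J] in O(n). *)
Lemma in_On1xOn2P a : in_On1xOn2 a <-> in_On a /\ J *m a *m J = a.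
Proof.
split=> [[a1 [a2 [h1 h2 ->]]]|[ao aJ]].
  rewrite /in_On/= tr_block_mx !mulmx_block !trmx0 !mulmx0 !mul0mx !addr0 !add0r.
  rewrite h1 h2 -scalar_mx_block; split => //.
  rewrite mul0mx mulmx1 mulmx1 mul1mx mul_scalar_mx mul_mx_scalar !scalerA.
  by rewrite mulrNN mulr1 scale1r.
have ur : ursubmx a = 0.
  apply/matrixP => i j; have := congr1 (fun b : 'M[R]_(n1 + n2) => b (lshift n2 i) (rshift n1 j)) aJ.
  rewrite mul_mx_sign mul_sign_mx block_sign_lshift block_sign_rshift !mxE mul1r mulrN1.
  by move/esym/eqP; rewrite -addr_eq0 -mulr2n mulrn_eq0 => /eqP.
have dl : dlsubmx a = 0.
  apply/matrixP => i j; have := congr1 (fun b : 'M[R]_(n1 + n2) => b (rshift n1 i) (lshift n2 j)) aJ.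
  rewrite mul_mx_sign mul_sign_mx block_sign_lshift block_sign_rshift !mxE mulr1 mulN1r.
  by move/esym/eqP; rewrite -addr_eq0 -mulr2n mulrn_eq0 => /eqP.
exists (ulsubmx a), (drsubmx a); have aE := submxK a; rewrite ur dl in aE.
move: ao; rewrite /in_On/= -aE block_mxKul block_mxKdr tr_block_mx !mulmx_block.
rewrite !trmx0 !mulmx0 !mul0mx !addr0 !add0r scalar_mx_block => /eq_block_mx[? _ _ ?].
by split.
Qed.

(** A [C] with these properties is the velocity of its Cayley transform, which
    commutes with [J] because [C] does. *)
Lemma lie_On1xOn2P C :
  lie_algebra (@in_On1xOn2 R n1 n2) C <-> C^T = - C /\ J *m C *m J = C.
Proof.
split=> [[a [ha a0 da]]|[aC JC]].
  split; first by apply: lie_On_antisym; exists a; split => // t; have [] := (in_On1xOn2P _).1 (ha t).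
  apply/matrixP => i j; rewrite mul_mx_sign mul_sign_mx mulrAC.
  have [_ <-] := is_derive_entry i j da.
  have aE : (fun t => a t i j) = (block_sign R i * block_sign R j) *: (fun t => a t i j).
    apply/funext => t; have [_ /(congr1 (fun b : 'M[R]_(n1 + n2) => b i j))] := (in_On1xOn2P _).1 (ha t).
    by rewrite mul_mx_sign mul_sign_mx mulrAC => {1}<-.
  rewrite {2}aE deriveZ//; have [] := is_derive_entry i j da => //.
exists (cayley C); split; [|exact: cayley0|exact: cayley_derive].
move=> t; apply/in_On1xOn2P; split; first exact: cayley_On.
rewrite /cayley; set s := t / 2; set B := _ - _; set B' := _ + _.
have JB : J *m B *m J = B.
  by rewrite /B mulmxBr mulmxBl mulmx1 sign_mx2 -scalemxAr -scalemxAl JC.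
have JB' : J *m B' *m J = B'.
  by rewrite /B' mulmxDr mulmxDl mulmx1 sign_mx2 -scalemxAr -scalemxAl JC.
have uB : B \in unitmx by exact: antisym_unitmx.
have J1 D : J *m (J *m D) = D by rewrite mulmxA sign_mx2 mul1mx.
have JV : J *m invmx B = invmx B *m J.
  apply: (can_inj (mulKmx uB)); rewrite mulKVmx// -{1}JB -!mulmxA J1.
  by rewrite mulmxV// mulmx1.
by rewrite mulmxA JV -!mulmxA (mulmxA J B') JB'.
Qed.

(** For antisymmetric [D], tr (D D) is minus the sum of the squared entries. *)
Lemma antisym_trace0 n (D : 'M[R]_n) : D^T = - D -> \tr (D *m D) = 0 -> D = 0.
Proof.
move=> aD tr0; have : \sum_i \sum_j D i j ^+ 2 = 0.
  apply/eqP; rewrite -oppr_eq0 -[X in _ == X]tr0 -sumrN; apply/eqP.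
  apply: eq_bigr => i _; rewrite mxE -sumrN; apply: eq_bigr => j _.
  have := congr1 (fun B : 'M[R]_n => B i j) aD; rewrite !mxE => ->.
  by rewrite mulrN expr2.
move/eqP; rewrite psumr_eq0 => [/allP H|i _]; last first.
  by apply: sumr_ge0 => j _; exact: sqr_ge0.
apply/matrixP => i j; rewrite mxE; have := H i (mem_index_enum _) => /=.
rewrite psumr_eq0 => [/allP/(_ j (mem_index_enum _))/=|k _]; last exact: sqr_ge0.
by rewrite sqrf_eq0 => /eqP.
Qed.

(** The orthogonal projection of [A] onto the matrices commuting with [J]: it
    keeps the two diagonal blocks and drops the others. *)
Definition block_part A := 2^-1 *: (A + J *m A *m J).

Lemma lie_component_block_part A : A^T = - A ->
  lie_component (@in_On1xOn2 R n1 n2) A (block_part A).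
Proof.
move=> aA; split.
  apply/lie_On1xOn2P; split.
    rewrite /block_part linearZ/= linearD/= !trmx_mul tr_sign_mx aA mulNmx mulmxN.
    by rewrite mulmxA -opprD scalerN.
  rewrite /block_part -scalemxAr -scalemxAl mulmxDr mulmxDl !mulmxA sign_mx2 mul1mx.
  by rewrite -(mulmxA A) sign_mx2 mulmx1 addrC.
move=> C /lie_On1xOn2P[_ JC].
have trJ : \tr (J *m A *m J *m C) = \tr (A *m C).
  by rewrite -[in RHS]JC -!mulmxA mxtrace_mulC -!mulmxA.
rewrite mulmxBl raddfB/= /block_part -scalemxAl mxtraceZ mulmxDl raddfD/= trJ.
set x := \tr (A *m C); rewrite -[x + x]mulr2n -[x *+ 2]mulr_natl mulrA mulVf ?pnatr_eq0//.
by rewrite mul1r subrr.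
Qed.

(** The form tr(AB) is definite on antisymmetric matrices, so the component
    in the Lie algebra of O(n1) x O(n2) is unique. *)
Lemma lie_component_unique A B : A^T = - A ->
  lie_component (@in_On1xOn2 R n1 n2) A B -> B = block_part A.
Proof.
move=> aA [hB trB]; have [hC trC] := lie_component_block_part aA.
have [aB JB] := (lie_On1xOn2P _).1 hB; have [aC JC] := (lie_On1xOn2P _).1 hC.
set C := block_part A in hC trC aC JC *.
have hD : lie_algebra (@in_On1xOn2 R n1 n2) (B - C).
  apply/lie_On1xOn2P; split; first by rewrite linearB/= aB aC opprB opprK addrC.
  by rewrite mulmxBr mulmxBl JB JC.
apply/eqP; rewrite -subr_eq0; apply/eqP; apply: antisym_trace0.
  by have [] := (lie_On1xOn2P _).1 hD.
have := trC _ hD; rewrite -[A - C](subrKA B) mulmxDl raddfD/= trB// add0r.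
by [].
Qed.

End BlockLie.

(** * The canonical connection *)

Section FrameMap.
Variables (R : realType) (n : nat) (M : manifold R n).
Implicit Types (u : frame M) (x y : 'cV[R]_n).

Lemma frame_mapD u x y : frame_map u (x + y) = frame_map u x + frame_map u y.
Proof.
rewrite /frame_map -big_split; apply: eq_bigr => i _.
by rewrite mxE scalerDl.
Qed.

Lemma frame_mapZ u (a : R) x : frame_map u (a *: x) = a *: frame_map u x.
Proof.
rewrite /frame_map scaler_sumr; apply: eq_bigr => i _.
by rewrite mxE scalerA.
Qed.

Lemma frame_map_delta u j : frame_map u (delta_mx j 0) = u.2 j.
Proof.
rewrite /frame_map (bigD1 j)//= mxE !eqxx scale1r big1 ?addr0// => i ij.
by rewrite mxE (negPf ij) scale0r.
Qed.

Lemma tangent_sub_sub (g : bilinear_field M) (Q Q' : set (frame M)) u xi :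
  Q `<=` Q' -> tangent_sub g Q u xi -> tangent_sub g Q' u xi.
Proof.
move=> QQ [txi xi0]; split => // F sF F0; apply: xi0 => //.
by apply: filterS F0 => w Fw /QQ.
Qed.

End FrameMap.

Section CanonicalConnection.
Variables (R : realType) (n1 n2 : nat) (M : manifold R (n1 + n2)).
Variables (P : endo_field M) (g : bilinear_field M).
Variables (nabla : field M -> field M -> field M) (omega : one_form M).
Hypothesis apr : almost_product_riemannian P g n1 n2.
Hypothesis rc : riemannian_connection g nabla.
Hypothesis cf : connection_form g (orthonormal_frames g) (@in_On R (n1 + n2)) omega.
Hypothesis cd : covariant_derivative g (orthonormal_frames g) omega nabla.
Let gM := ap_metric apr.
Let PL := ap_linear apr.
Let ac := riemannian_affine rc.
Local Notation Q := (adapted_frames g P).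
Local Notation J := (sign_mx R n1 n2).
Implicit Types (X Y : field M) (u w : frame M).

Lemma adapted_orthonormal : Q `<=` orthonormal_frames g.
Proof. by move=> u []. Qed.

Lemma vector_field_app Y : vector_field Y -> vector_field (app P Y).
Proof. by move=> vY p; exact: (ap_smooth apr). Qed.

Lemma vector_field_tangent Y p : vector_field Y -> tangent p (Y p).
Proof. by move=> vY; exact: smooth_field_tangent. Qed.

Lemma app_involutive Y : vector_field Y -> app P (app P Y) = Y.
Proof.
by move=> vY; apply/funext => p; apply: (ap_square apr); exact: vector_field_tangent.
Qed.

(** As [P] is an involutive isometry, g(u_i, P Y) = g(P u_i, Y), and P u_i is
    u_i or - u_i in an adapted frame. *)
Lemma adapted_coords u Y i : vector_field Y -> Q u ->
  frame_coords g (app P Y) u i 0 = block_sign R i * frame_coords g Y u i 0.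
Proof.
move=> vY [[tu _] Pu]; rewrite !mxE.
have tY := vector_field_tangent u.1 vY; have tPY := ap_tangent apr tY.
rewrite -(ap_isometry apr (tu i) tPY) (ap_square apr tY).
have -> : P u.1 (u.2 i) = block_sign R i *: u.2 i.
  rewrite -frame_map_delta Pu -frame_mapZ; congr frame_map.
  apply/colP => j; rewrite mul_sign_mx !mxE.
  by case: (eqVneq j i) => [->|]; rewrite ?andFb ?mulr0.
by rewrite (metricZ gM).
Qed.

(** The function (P Y)_i - (+-1) Y_i vanishes on the adapted frames, so a vector
    tangent to them annihilates it. *)
Lemma adapted_derivative u xi Y : vector_field Y -> Q u -> tangent_sub g Q u xi ->
  \col_i xi (fun w => frame_coords g (app P Y) w i 0) =
  J *m \col_i xi (fun w => frame_coords g Y w i 0).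
Proof.
move=> vY Qu [txi xi0]; apply/colP => i; rewrite mul_sign_mx !mxE.
have sY := frame_smooth_coords g i (vY u.1).
have sPY := frame_smooth_coords g i (vector_field_app vY u.1).
pose D w := frame_coords g (app P Y) w i 0 + - block_sign R i * frame_coords g Y w i 0.
have lin : frame_nbhs g u [set w | D w = frame_coords g (app P Y) w i 0 +
    - block_sign R i * frame_coords g Y w i 0] by exact: filterE.
have sD : frame_smooth_at g u D.
  apply: (@frame_smooth_comp _ _ _ g u 2 (fun k => if k == 0
    then fun w => frame_coords g (app P Y) w i 0 else fun w => frame_coords g Y w i 0)
    (fun x => x 0 0 + - block_sign R i * x 0 1)) => [|k||].
  - exact: adapted_orthonormal.
  - by case: ifP.
  - apply: smooth_nearD; first exact: smooth_near_coord.
    by apply: smooth_nearM; [exact: smooth_near_cst|exact: smooth_near_coord].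
  - by apply: filterE => w /=; rewrite [X in _ = X + _]mxE [X in _ = _ + _ * X]mxE.
have := tangent_vector_lin txi sPY sY lin; rewrite xi0//; last first.
  by apply: filterE => w Qw; rewrite /D adapted_coords// mulNr subrr.
by move/esym/eqP; rewrite mulNr subr_eq0 => /eqP.
Qed.

(** The connection form [block_part omega] defines the derivative
    (nabla Y + P nabla (P Y))/2: conjugating the connection form by [J] amounts
    to conjugating the covariant derivative by [P]. *)
Lemma block_part_derivative X Y u xi : vector_field X -> vector_field Y ->
  Q u -> tangent_sub g Q u xi -> lies_over u xi (X u.1) ->
  frame_map u (\col_i xi (fun w => frame_coords g Y w i 0)
               + block_part (omega u xi) *m frame_coords g Y u) =
  2^-1 *: (nabla X Y u.1 + P u.1 (nabla X (app P Y) u.1)).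
Proof.
move=> vX vY Qu txi lxi; have ou := adapted_orthonormal Qu.
have toxi := tangent_sub_sub adapted_orthonormal txi.
rewrite (cd vX vY ou toxi lxi) (cd vX (vector_field_app vY) ou toxi lxi).
rewrite (adapted_derivative vY Qu txi).
have -> : frame_coords g (app P Y) u = J *m frame_coords g Y u.
  by apply/colP => i; rewrite mul_sign_mx adapted_coords.
rewrite Qu.2 -frame_mapD -frame_mapZ; congr frame_map.
set x := \col_i _; set y := frame_coords _ _ _; set A := omega u xi.
rewrite mulmxDr !mulmxA sign_mx2 mul1mx addrACA scalerDr; congr (_ + _).
  by rewrite -[x + x]mulr2n -[x *+ 2]scaler_nat scalerA mulVf ?scale1r// pnatr_eq0.
by rewrite /block_part -scalemxAl mulmxDl.
Qed.

Lemma omega_antisym u xi : Q u -> tangent_sub g Q u xi ->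
  (omega u xi)^T = - omega u xi.
Proof.
move=> Qu txi; apply: lie_On_antisym.
apply: (form_lie cf) (adapted_orthonormal Qu) _.
exact: tangent_sub_sub adapted_orthonormal txi.
Qed.

(** The Leibniz rule for a constant factor, which tangent vectors annihilate. *)
Lemma nabla_scale X Y (a : R) : vector_field X -> vector_field Y ->
  nabla X (fscale (fun=> a) Y) = fscale (fun=> a) (nabla X Y).
Proof.
move=> vX vY; rewrite (connection_leibniz ac)//; last first.
  by move=> p; exact: smooth_at_cst.
apply/funext => p.
rewrite -[LHS]/(X p (fun=> a) *: Y p + fscale (fun=> a) (nabla X Y) p).
rewrite (tangent_vector_cst (vector_field_tangent p vX) (a := a)) ?scale0r ?add0r//.
exact: nearW.
Qed.

Lemma vector_fieldZ Y (a : R) : vector_field Y -> vector_field (fscale (fun=> a) Y).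
Proof. by move=> vY p; apply: smooth_fieldZ => //; exact: smooth_at_cst. Qed.

Lemma vector_fieldD X Y : vector_field X -> vector_field Y -> vector_field (X + Y).
Proof. by move=> vX vY p; exact: smooth_fieldD. Qed.

Lemma nabla_pi1 X Y p : vector_field X -> vector_field Y ->
  nabla X (app (pi1 P) Y) p = 2^-1 *: (nabla X Y p + nabla X (app P Y) p).
Proof.
move=> vX vY; have vPY := vector_field_app vY.
rewrite -[app (pi1 P) Y]/(fscale (fun=> 2^-1) (Y + app P Y)).
rewrite nabla_scale//; last exact: vector_fieldD.
by rewrite (connection_additive ac).
Qed.

Lemma nabla_pi2 X Y p : vector_field X -> vector_field Y ->
  nabla X (app (pi2 P) Y) p = 2^-1 *: (nabla X Y p - nabla X (app P Y) p).
Proof.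
move=> vX vY; have vPY := vector_field_app vY.
have -> : app (pi2 P) Y = fscale (fun=> 2^-1) (Y + fscale (fun=> -1) (app P Y)).
  apply/funext => q.
  rewrite -[RHS]/(2^-1 *: (Y q + (-1) *: P q (Y q))) scaleN1r.
  by [].
rewrite nabla_scale//; last by apply: vector_fieldD => //; exact: vector_fieldZ.
rewrite (connection_additive ac)//; last exact: vector_fieldZ.
rewrite nabla_scale// -[LHS]/(2^-1 *: (nabla X Y p + (-1) *: nabla X (app P Y) p)).
by rewrite scaleN1r.
Qed.

(** An adapted frame at [p] and a tangent vector over [X p] are taken from a
    local section of the bundle of adapted frames; evaluating there the equation
    that defines the covariant derivative determines it. *)
Lemma canonical_derivative nablabar X Y p :
  canonical_connection g Q (@in_On1xOn2 R n1 n2) omega nablabar ->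
  vector_field X -> vector_field Y ->
  nablabar X Y p = 2^-1 *: (nabla X Y p + P p (nabla X (app P Y) p)).
Proof.
move=> [omega_h lc cdb] vX vY.
have [S [sS aS]] := adapted_local_frame apr p.
have oS : \forall q \near p, orthonormal_frames g (q, fun i => S i q).
  by apply: filterS aS => q; exact: adapted_orthonormal.
pose u : frame M := (p, fun i => S i p).
have Qu : Q u by exact: nbhs_singleton aS.
pose xi := frame_pushforward g p S (X p).
have txi : tangent_sub g Q u xi.
  by apply: (frame_pushforward_tangent gM sS oS) => //; exact: vector_field_tangent.
have lxi : lies_over u xi (X p) by exact: frame_pushforward_over.
have := cdb X Y u xi vX vY Qu txi lxi.
rewrite (lie_component_unique (omega_antisym Qu txi) (lc u xi Qu txi)).
by move->; exact: block_part_derivative.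
Qed.

End CanonicalConnection.

Theorem theorem5p1 (R : realType) (n1 n2 : nat) (M : manifold R (n1 + n2))
  (P : endo_field M) (g : bilinear_field M)
  (nabla : field M -> field M -> field M) (omega : one_form M) :
  almost_product_riemannian P g n1 n2 ->
  riemannian_connection g nabla ->
  connection_form g (orthonormal_frames g) (@in_On R (n1 + n2)) omega ->
  covariant_derivative g (orthonormal_frames g) omega nabla ->
  (exists nablabar : field M -> field M -> field M,
     canonical_connection g (adapted_frames g P) (@in_On1xOn2 R n1 n2)
       omega nablabar) /\
  (forall nablabar : field M -> field M -> field M,
     canonical_connection g (adapted_frames g P) (@in_On1xOn2 R n1 n2)
       omega nablabar ->
     forall X Y : field M, vector_field X -> vector_field Y ->
     [/\ nablabar X Y
           = nabla X Y - 2^-1 *: cov_endo nabla X P (app P Y),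
         nablabar X Y
           = app (pi1 P) (nabla X (app (pi1 P) Y))
             + app (pi2 P) (nabla X (app (pi2 P) Y)),
         nabla X Y - nablabar X Y
           = app (pi1 P) (nabla X (app (pi2 P) Y))
             + app (pi2 P) (nabla X (app (pi1 P) Y)) &
         nabla X Y - nablabar X Y
           = 2^-1 *: cov_endo nabla X P (app P Y)]).
Proof.
move=> apr rc cf cd; split.
  exists (fun X Y p => 2^-1 *: (nabla X Y p + P p (nabla X (app P Y) p))).
  exists (fun u xi => block_part (omega u xi)) => [u xi Qu txi|X Y u xi vX vY Qu txi lxi].
    by apply: lie_component_block_part; exact: (omega_antisym cf Qu txi).
  by apply/esym; exact: block_part_derivative.
move=> nablabar can X Y vX vY.
have vPY := vector_field_app apr vY.
have conn Z : vector_field Z -> vector_field (nabla X Z).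
  by move=> vZ; exact: (connection_field (riemannian_affine rc)) vX vZ.
have nE p : nablabar X Y p = 2^-1 *: (nabla X Y p + P p (nabla X (app P Y) p)).
  exact: (canonical_derivative apr cf cd p can vX vY).
have covE p : cov_endo nabla X P (app P Y) p = nabla X Y p - P p (nabla X (app P Y) p).
  by rewrite /cov_endo (app_involutive apr).
have ta p : tangent p (nabla X Y p) by exact/vector_field_tangent/conn.
have tb p : tangent p (nabla X (app P Y) p) by exact/vector_field_tangent/conn.
have P1 p : P p (nabla X (app (pi1 P) Y) p) =
    2^-1 *: (P p (nabla X Y p) + P p (nabla X (app P Y) p)).
  rewrite (nabla_pi1 apr rc)// (endoZ (ap_linear apr)); last exact: tangentD.
  by rewrite (endoD (ap_linear apr)).
have P2 p : P p (nabla X (app (pi2 P) Y) p) =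
    2^-1 *: (P p (nabla X Y p) - P p (nabla X (app P Y) p)).
  rewrite (nabla_pi2 apr rc)// -scaleN1r (endoZ (ap_linear apr)); last first.
    by apply: tangentD => //; exact: tangentZ.
  rewrite (endoD (ap_linear apr))//; last exact: tangentZ.
  by rewrite (endoZ (ap_linear apr))// scaleN1r.
have opD (v w : operator R M) f : (v + w) f = v f + w f by [].
have opN (v : operator R M) f : (- v) f = - v f by [].
have opZ (a : R) (v : operator R M) f : (a *: v) f = a * v f by [].
have fD (Z W : field M) p : (Z + W) p = Z p + W p by [].
have fN (Z : field M) p : (- Z) p = - Z p by [].
have fZ (a : R) (Z : field M) p : (a *: Z) p = a *: Z p by [].
have p1E Z p : app (pi1 P) Z p = 2^-1 *: (Z p + P p (Z p)) by [].
have p2E Z p : app (pi2 P) Z p = 2^-1 *: (Z p - P p (Z p)) by [].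
(* Each formula is now a linear identity between nabla_X Y, nabla_X (P Y) and
   their images under [P], which is checked on every function [f]. *)
split; apply/funext => p; apply/funext => f;
  rewrite ?(fD, fN, fZ, p1E, p2E) ?(nE, covE, P1, P2) ?(nabla_pi1 apr rc, nabla_pi2 apr rc)//
    ?(opD, opN, opZ).
all: by field.
Qed.
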